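(* Consider the uncertain MIMO nonlinear system $x^{(n)}=h(X)+g(X)\tau$ with reference $x_r$, errors $e_1,\dots,e_n,r$, and the continuous robust controller $$\tau(t)=DK\Big[e_n(t)-e_n(t_0)+\alpha\int_{t_0}^t e_n(\sigma)\,d\sigma\Big]+D\Pi(t),\qquad \dot\Pi=C\,\mathrm{Sgn}(e_n),\quad \Pi(t_0)=0,$$ with $K=I_m+k_pI_m+\mathrm{diag}\{k_{d,1},\dots,k_{d,m-1},0\}$, all as specified in the context. Suppose that (i) $\lambda_{\min}(\alpha)\ge \tfrac12$; (ii) the diagonal entries $C_1,\dots,C_m$ of $C$ satisfy $$C_m\ge \zeta_{\bar N_m}\Big(1+\frac{\gamma_2}{\alpha_m}\Big),\qquad C_i\ge\Big(\zeta_{\bar N_i}+\sum_{j=i+1}^m\zeta_{\Omega_{i,j}}C_j\Big)\Big(1+\frac{\gamma_2}{\alpha_i}\Big),\quad i=1,\dots,m-1,$$ where $\gamma_1,\gamma_2>0$ are constants such that along the closed-loop solution, for all $i=1,\dots,m$ and $t\ge t_0$, $$\int_{t_0}^t|\dot e_{n,i}(\sigma)|\,d\sigma\le\gamma_1+\gamma_2\int_{t_0}^t|e_{n,i}(\sigma)|\,d\sigma+|e_{n,i}(t)|;$$ (iii) the gains $k_p$ and $k_{d,1},\dots,k_{d,m-1}$ are chosen large enough (in the sense made precise in the context). Then all closed-loop signals remain bounded on $[t_0,\infty)$, and the tracking error converges to zero asymptotically in the sense that $$e_1^{(i)}(t)\to 0\quad\text{as } t\to+\infty,\qquad i=0,1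,\dots,n.$$
   Context: System. $x(t)\in\mathbb{R}^m$, $X=[x^T,\dot x^T,\dots,(x^{(n-1)})^T]^T\in\mathbb{R}^{mn}$ is measurable (available to the controller), $\tau(t)\in\mathbb{R}^m$ is the control input, and $x^{(n)}=h(X)+g(X)\tau$, where $h(X)\in\mathbb{R}^m$ and $g(X)\in\mathbb{R}^{m\times m}$ are uncertain and $g(X)$ is a real matrix all of whose leading principal minors are non-zero. One uses the decomposition $g(X)=S(X)DU(X)$ with $S$ symmetric positive definite, $D=\mathrm{diag}\{d_1,\dots,d_m\}$ a constant diagonal matrix with entries $\pm1$ (assumed known), and $U$ unity upper triangular (upper triangular with ones on the diagonal). Put $M(X)=S^{-1}(X)$; it is assumed that $\underline m\|\chi\|^2\le\chi^TM(X)\chi\le\bar m(X)\|\chi\|^2$ for all $\chi\in\mathbb{R}^m$, with $\underline m>0$ a constant and $\bar m$ a positive non-decreasing function. Put $\varphi(X,x^{(n)})=\dot h+\dot g g^{-1}(x^{(n)}-h)$ and $f(X,x^{(n)})=S^{-1}\varphi$. Reference. $x_r(t)\in\mathbb{R}^m$ satisfies $x_r\in\mathcal{C}^n$ and $x_r^{(i)}\in\mathcal{L}_\infty$ for $i=0,\dots,n+1$; $X_r=[x_r^T,\dot x_r^T,\dots,(x_r^{(n-1)})^T]^T$. Errors. $e_1=x_r-x$, $e_2=\dot e_1+e_1$, $e_i=\dot e_{i-1}+e_{i-1}+e_{i-2}$ for $3\le i\le n$; thus $e_i=\sum_{j=0}^{i-1}a_{i,j}e_1^{(j)}$ with known positive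 constants $a_{i,j}$, $a_{n,n-1}=1$. The filtered error is $r=\dot e_n+\alpha e_n$, with $\alpha=\mathrm{diag}\{\alpha_1,\dots,\alpha_m\}$ a constant positive definite diagonal gain matrix; $\lambda_{\min}(\alpha)$ is its smallest eigenvalue. $e_{n,i}$ is the $i$-th entry of $e_n$. $z=[e_1^T,\dots,e_n^T,r^T]^T\in\mathbb{R}^{(n+1)m}$. Auxiliary functions. $N(X,x^{(n)},t)=M\big(x_r^{(n+1)}+\sum_{j=0}^{n-2}a_{n,j}e_1^{(j+2)}+\alpha\dot e_n\big)-f+e_n+\tfrac12\dot M r$; $\bar N=N|_{X=X_r,\,x^{(n)}=x_r^{(n)}}$, $\widetilde N=N-\bar N$; $\bar U=U|_{X=X_r}$, with entries $\bar U_{i,j}$, and $\widetilde U_{i,j}=U_{i,j}-\bar U_{i,j}$; $\Omega=D(\bar U-I_m)D$, which is strictly upper triangular. Standing bounds. The uncertainties $h,g$ are assumed smooth enough that: $\|\widetilde N\|\le\rho_{\widetilde N}(\|z\|)\|z\|$ and $|\widetilde U_{i,j}|\le\rho_{i,j}(\|z\|)\|z\|$ with non-negative, globally invertible, non-decreasing functions $\rho_{\widetilde N},\rho_{i,j}$; and $|\bar N_i(t)|\le\zeta_{\bar N_i}$, $|\bar U_{i,j}(t)|\le\zeta_{\bar U_{i,j}}$, $|\Omega_{i,j}(t)|\le\zeta_{\Omega_{i,j}}$ with positive constants. Controller gains. $K$ and $C=\mathrm{diag}\{C_1,\dots,C_m\}$ are constant, diagonal, positive definite; $k_p,k_{d,i}>0$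 are constants; $\mathrm{Sgn}$ is the entrywise signum function. Consequently $\dot\tau=DKr+DC\,\mathrm{Sgn}(e_n)$. ''Large enough'': given the initial conditions, $\alpha$, $C$, and $\gamma_1,\gamma_2$, there is a threshold such that $k_p$ exceeds it, and then, successively for $i=m-1,m-2,\dots,1$, a threshold for $k_{d,i}$ (depending on these data and on the already chosen $k_p,k_{d,m-1},\dots,k_{d,i+1}$) such that $k_{d,i}$ exceeds it. The gains may thus depend on the initial conditions (semi-global result). ''All closed-loop signals'' means $x,\dot x,\dots,x^{(n)}$, $e_1,\dots,e_n$, $r$, $\tau$, $\dot\tau$. *)

(* Defs.v *)
From HB Require Import structures.
From mathcomp Require Import all_boot all_order all_algebra.
From mathcomp Require Import all_classical all_reals all_analysis.
Import Order.TTheory GRing.Theory Num.Theory.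
Import numFieldNormedType.Exports.

Set Implicit Arguments.
Unset Strict Implicit.
Unset Printing Implicit Defensive.

Local Open Scope classical_set_scope.
Local Open Scope ring_scope.

Section LinearAlgebra.
Context {R : realType}.

(* Euclidean norm; the norm that the library puts on matrices is the sup norm. *)
Definition enorm m n (A : 'M[R]_(m, n)) : R :=
  Num.sqrt (\sum_i \sum_j A i j ^+ 2).

Definition qform m (A : 'M[R]_m) (v : 'cV[R]_m) : R := (v^T *m A *m v) 0 0.

Definition sym_posdef m (A : 'M[R]_m) : Prop :=
  A^T = A /\ forall v : 'cV[R]_m, v != 0 -> 0 < qform A v.

Definition unit_upper_triangular m (A : 'M[R]_m) : Prop :=
  (forall i j : 'I_m, (j < i)%N -> A i j = 0) /\ (forall i, A i i = 1).

Definition leading_minor m (A : 'M[R]_m) k (le_km : (k <= m)%N) : R :=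
  \det (mxsub (widen_ord le_km) (widen_ord le_km) A).

Definition leading_minors_neq0 m (A : 'M[R]_m) : Prop :=
  forall k (le_km : (k <= m)%N), leading_minor A le_km != 0.

Definition is_lambda_min m (A : 'M[R]_m) (l : R) : Prop :=
  eigenvalue A l /\ forall a, eigenvalue A a -> l <= a.

End LinearAlgebra.

Section Calculus.
Context {R : realType}.

(* Derivative relative to D: two-sided at interior points of D, one-sided at
   the left end point of an interval [t0, T[. *)
Definition deriv_within (V : normedModType R) (D : set R) (f : R -> V)
    (t : R) (l : V) : Prop :=
  (s - t)^-1 *: (f s - f t) @[s --> within D t^'] --> l.

(* Continuity of X |-> 'd F X H for every H is continuity of the differential
   in finite dimension. *)
Definition C1 (V W : normedModType R) (F : V -> W) : Prop :=
  (forall X, differentiable F X) /\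
  (forall H : V, continuous (fun X => 'd F X H : W)).

Definition time_dom (t0 : R) (T : \bar R) : set R :=
  [set t | t0 <= t /\ (t%:E < T)%E].

Definition sint (a b : R) (f : R -> R) : R :=
  \int[lebesgue_measure]_(s in `[a, b]) f s.

Definition vint m (a b : R) (f : R -> 'cV[R]_m) : 'cV[R]_m :=
  \col_i sint a b (fun s => f s i 0).

(* Non-negative, non-decreasing and invertible from [0, +oo[ onto
   [rho 0, +oo[; rho 0 = 0 is not imposed. *)
Definition bounding_fun (rho : R -> R) : Prop :=
  [/\ forall u, 0 <= u -> 0 <= rho u,
      forall u v, 0 <= u -> u <= v -> rho u <= rho v &
      set_bij `[0, +oo[ `[rho 0, +oo[ rho].

Definition Sgn m (v : 'cV[R]_m) : 'cV[R]_m := \col_i Num.sg (v i 0).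

(* s is an admissible value of the discontinuous signal Sgn(v) in the sense of
   Filippov: the signum of each non-zero entry, any number of [-1, 1] where
   the entry vanishes. *)
Definition Sgn_value m (v s : 'cV[R]_m) : Prop :=
  forall i, (v i 0 != 0 -> s i 0 = Num.sg (v i 0)) /\
    (v i 0 = 0 -> `|s i 0| <= 1).

Lemma Sgn_value_Sgn m (v : 'cV[R]_m) : Sgn_value v (Sgn v).
Proof.
by move=> i; rewrite mxE; split=> // ->; rewrite sgr0 normr0 ler01.
Qed.

(* P holds for the list [:: c_1; ...; c_k] ++ l as soon as c_k, ..., c_1 are
   chosen in this order, each of them above a threshold that depends on the
   elements already chosen. *)
Fixpoint successively_large (k : nat) (l : seq R) (P : seq R -> Prop) : Prop :=
  if k is k'.+1 then
    exists th : R, forall c : R, 0 < c -> th < c ->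
      successively_large k' (c :: l) P
  else P l.

End Calculus.

(* A jet is a family p with p j the value at some instant of the j-th
   derivative of an 'cV_m-valued signal; d/dt acts on jets as a shift. *)
Section Errors.
Context {R : realType} {m : nat}.
Implicit Types p e : nat -> 'cV[R]_m.

Definition jshift p : nat -> 'cV[R]_m := fun j => p j.+1.

(* The state [p 0; ...; p (n-1)] of R^(mn) is stored by columns. *)
Definition state n p : 'M[R]_(m, n) := \matrix_(i, j) p j i 0.

(* err i e is e_i in terms of the jet e of e_1, for i >= 1; the convention
   err 0 e = 0 makes e_2 an instance of the general recursion. *)
Fixpoint err (i : nat) e : 'cV[R]_m :=
  match i with
  | 0 => 0
  | 1 => e 0%N
  | (i'.+1 as i1).+1 => err i1 (jshift e) + err i1 e + err i' e
  end.

(* The integers a_{i,j} in e_i = \sum_(j < i) a_{i,j} e_1^(j). *)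
Fixpoint acoef (i j : nat) : nat :=
  match i with
  | 0 => 0
  | 1 => (j == 0)%N
  | (i'.+1 as i1).+1 =>
      ((if j is j'.+1 then acoef i1 j' else 0) + acoef i1 j + acoef i' j)%N
  end.

Lemma acoef_ge i j : (i <= j)%N -> acoef i j = 0%N.
Proof.
elim/ltn_ind: i j => -[|[|i]] IH [|j] // ij.
rewrite -[LHS]/(acoef i.+1 j + acoef i.+1 j.+1 + acoef i j.+1)%N.
by rewrite !IH // (leq_trans _ ij) // ltnW.
Qed.

Lemma acoef_diag i : acoef i.+1 i = 1%N.
Proof.
elim: i => [//|i IH].
rewrite -[LHS]/(acoef i.+1 i + acoef i.+1 i.+1 + acoef i i.+1)%N.
by rewrite IH !acoef_ge.
Qed.

Lemma acoef_gt0 i j : (j < i)%N -> (0 < acoef i j)%N.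
Proof.
elim/ltn_ind: i j => -[|[|i]] IH [|j] // ij.
  rewrite -[X in (0 < X)%N]/(0 + acoef i.+1 0 + acoef i 0)%N.
  by rewrite !addn_gt0 IH.
rewrite -[X in (0 < X)%N]/(acoef i.+1 j + acoef i.+1 j.+1 + acoef i j.+1)%N.
by rewrite !addn_gt0 IH.
Qed.

Lemma errE i e : err i e = \sum_(j < i) (acoef i j)%:R *: e j.
Proof.
elim/ltn_ind: i e => -[|[|i]] IH e; first by rewrite big_ord0.
  by rewrite big_ord1 /= scale1r.
rewrite -[LHS]/(err i.+1 (jshift e) + err i.+1 e + err i e) !IH //.
have w k : (k <= i.+2)%N -> \sum_(j < k) (acoef k j)%:R *: e j =
    \sum_(j < i.+2) (acoef k j)%:R *: e j.
  move=> ki; rewrite (big_ord_widen _ (fun j => (acoef k j)%:R *: e j) ki).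
  rewrite [RHS](bigID (fun j : 'I__ => (j < k)%N)) /= [X in _ = _ + X]big1.
    by rewrite addr0.
  by move=> j; rewrite -leqNgt => /acoef_ge ->; rewrite scale0r.
have -> : \sum_(j < i.+1) (acoef i.+1 j)%:R *: jshift e j =
    \sum_(j < i.+2) (if val j is j'.+1 then acoef i.+1 j' else 0%N)%:R *: e j.
  by rewrite [RHS]big_ord_recl /= scale0r add0r.
rewrite (w i.+1) // (w i) ?(leq_trans (leqnSn i)) // -!big_split.
apply: eq_bigr => j _ /=.
by rewrite -!scalerDl -!natrD.
Qed.

(* e_(i+1) = d(e_i)/dt + e_i + e_(i-1) along the jet of a signal. *)
Lemma err_deriv (D : set R) (e : nat -> R -> 'cV[R]_m) i t :
  (forall j, (j < i)%N -> deriv_within D (e j) t (e j.+1 t)) ->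
  deriv_within D (fun s => err i (e ^~ s)) t (err i (jshift (e ^~ t))).
Proof.
elim/ltn_ind: i e => -[|[|i]] IH e He.
- rewrite /deriv_within /=; under eq_fun do rewrite subr0 scaler0.
  exact: cvg_cst.
- exact: (He 0%N).
have H1 : deriv_within D (fun s => err i.+1 (jshift (e ^~ s))) t
    (err i.+1 (jshift (jshift (e ^~ t)))).
  by apply: (IH i.+1 _ (fun j => e j.+1)) => // j ji; exact: He.
have H2 : deriv_within D (fun s => err i.+1 (e ^~ s)) t
    (err i.+1 (jshift (e ^~ t))).
  by apply: IH => // j ji; apply: He; exact: ltnW.
have H3 : deriv_within D (fun s => err i (e ^~ s)) t (err i (jshift (e ^~ t))).
  by apply: IH => // j ji; apply: He; do 2!apply: ltnW.
apply: cvg_trans (cvgD (cvgD H1 H2) H3); apply: near_eq_cvg.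
near=> s; rewrite -[err i.+2 (e ^~ s)]/(err i.+1 (jshift (e ^~ s))
  + err i.+1 (e ^~ s) + err i (e ^~ s)).
rewrite -[err i.+2 (e ^~ t)]/(err i.+1 (jshift (e ^~ t))
  + err i.+1 (e ^~ t) + err i (e ^~ t)).
rewrite !fctE -!scalerDr; congr (_ *: _).
by rewrite [in RHS]opprD [RHS]addrACA; congr (_ + _); rewrite opprD addrACA.
Unshelve. all: by end_near. Qed.

(* The filtered error r = d(e_n)/dt + alpha e_n. *)
Definition filtered (al : 'rV[R]_m) n e : 'cV[R]_m :=
  err n (jshift e) + diag_mx al *m err n e.

(* z = [e_1; ...; e_n; r] of R^((n+1)m), stored by columns. *)
Definition zvec (al : 'rV[R]_m) n e : 'M[R]_(m, n.+1) :=
  \matrix_(i, j) (if (j < n)%N then err j.+1 e else filtered al n e) i 0.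

End Errors.

Section Plant.
Context {R : realType} {m n : nat}.
Variables (h : 'M[R]_(m, n) -> 'cV[R]_m) (g S U : 'M[R]_(m, n) -> 'M[R]_m).
Variables (d al : 'rV[R]_m) (xr : nat -> R -> 'cV[R]_m).
Implicit Types p : nat -> 'cV[R]_m.

Definition SDU_decomposition : Prop :=
  [/\ forall i, d 0 i = 1 \/ d 0 i = -1,
      forall X, sym_posdef (S X),
      forall X, unit_upper_triangular (U X) &
      forall X, g X = S X *m diag_mx d *m U X].

Definition Mmat (X : 'M[R]_(m, n)) : 'M[R]_m := invmx (S X).

(* Time derivatives of h(X), g(X) and M(X) along a trajectory of jet p, given
   by the chain rule: X = state n p has time derivative state n (jshift p). *)
Definition hdot p : 'cV[R]_m := 'd h (state n p) (state n (jshift p)).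
Definition gdot p : 'M[R]_m := 'd g (state n p) (state n (jshift p)).
Definition Mdot p : 'M[R]_m := 'd Mmat (state n p) (state n (jshift p)).

(* varphi and f as functions of (X, x^(n)) = (state n p, p n). *)
Definition phifun p : 'cV[R]_m :=
  hdot p + gdot p *m invmx (g (state n p)) *m (p n - h (state n p)).
Definition ffun p : 'cV[R]_m := Mmat (state n p) *m phifun p.

(* The jet of e_1 = x_r - x at time t when x has jet p. *)
Definition ejet p (t : R) : nat -> 'cV[R]_m := fun j => xr j t - p j.

Definition Nfun p (t : R) : 'cV[R]_m :=
  let e := ejet p t in
  Mmat (state n p) *m
    (xr n.+1 t + \sum_(j < n.-1) (acoef n j)%:R *: e j.+2
       + diag_mx al *m err n (jshift e))
  - ffun p + err n e + 2^-1 *: (Mdot p *m filtered al n e).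

Definition Nbar (t : R) : 'cV[R]_m := Nfun (xr ^~ t) t.
Definition Ntilde p (t : R) : 'cV[R]_m := Nfun p t - Nbar t.

Definition Ubar (t : R) : 'M[R]_m := U (state n (xr ^~ t)).
Definition Utilde p (t : R) : 'M[R]_m := U (state n p) - Ubar t.
Definition Omega (t : R) : 'M[R]_m :=
  diag_mx d *m (Ubar t - 1%:M) *m diag_mx d.

(* x_r is C^n on [t0, +oo[ with xr j its j-th derivative, j <= n; x_r^(n+1) is
   an L_oo function, hence a derivative of x_r^(n) in the sense of Lebesgue. *)
Definition reference (t0 : R) : Prop :=
  [/\ forall j, (j < n)%N -> forall t, t0 <= t ->
        deriv_within `[t0, +oo[ (xr j) t (xr j.+1 t),
      {within `[t0, +oo[, continuous (xr n)},
      forall j, (j <= n)%N -> exists B, forall t, t0 <= t ->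
        enorm (xr j t) <= B,
      (forall i, measurable_fun `[t0, +oo[ (fun t => xr n.+1 t i 0)) /\
      (exists B, {ae (@lebesgue_measure R), forall t, t0 <= t ->
        enorm (xr n.+1 t) <= B}) &
      forall t, t0 <= t -> xr n t = xr n t0 + vint t0 t (xr n.+1)].

Section ClosedLoop.
Variables (c : 'rV[R]_m) (K : 'M[R]_m) (t0 : R).
(* x j is the j-th derivative of the trajectory and s the signal Sgn(e_n). *)
Variables (x : nat -> R -> 'cV[R]_m) (s : R -> 'cV[R]_m).

Definition traj_err (t : R) : nat -> 'cV[R]_m := ejet (x ^~ t) t.

Definition Pi_signal (t : R) : 'cV[R]_m :=
  vint t0 t (fun sigma => diag_mx c *m s sigma).

Definition control (t : R) : 'cV[R]_m :=
  diag_mx d *m K *m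
    (err n (traj_err t) - err n (traj_err t0)
       + diag_mx al *m vint t0 t (fun sigma => err n (traj_err sigma)))
  + diag_mx d *m Pi_signal t.

Definition control_rate (t : R) : 'cV[R]_m :=
  diag_mx d *m K *m filtered al n (traj_err t)
  + diag_mx d *m diag_mx c *m s t.

(* x, of control signal [control], solves the closed loop on [t0, T[ with
   initial state X0. Sgn(e_n) is understood in the sense of Filippov; the
   choice s t = Sgn (e_n t) is admissible (Sgn_value_Sgn). T = +oo gives the
   solutions on [t0, +oo[; boundedness for T finite excludes finite escape. *)
Definition closed_loop_solution (T : \bar R) (X0 : 'M[R]_(m, n)) : Prop :=
  [/\ state n (x ^~ t0) = X0,
      forall j, (j < n)%N -> forall t, time_dom t0 T t ->
        deriv_within (time_dom t0 T) (x j) t (x j.+1 t),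
      forall t, time_dom t0 T t ->
        x n t = h (state n (x ^~ t)) + g (state n (x ^~ t)) *m control t,
      forall i, measurable_fun (time_dom t0 T) (fun t => s t i 0) &
      forall t, time_dom t0 T t -> Sgn_value (err n (traj_err t)) (s t)].

Definition error_rate_bound (T : \bar R) (gam1 gam2 : R) : Prop :=
  forall (i : 'I_m) t, time_dom t0 T t ->
    sint t0 t (fun sigma => `|err n (jshift (traj_err sigma)) i 0|)
    <= gam1 + gam2 * sint t0 t (fun sigma => `|err n (traj_err sigma) i 0|)
       + `|err n (traj_err t) i 0|.

Definition signals_bounded (T : \bar R) : Prop :=
  exists B : R, forall t, time_dom t0 T t ->
    [/\ forall j, (j <= n)%N -> enorm (x j t) <= B,
        forall i, (1 <= i <= n)%N -> enorm (err i (traj_err t)) <= B,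
        enorm (filtered al n (traj_err t)) <= B,
        enorm (control t) <= B &
        enorm (control_rate t) <= B].

Definition tracking : Prop :=
  forall i, (i <= n)%N ->
    (traj_err t i : 'cV[R]_m) @[t --> +oo] --> (0 : 'cV[R]_m).

End ClosedLoop.
End Plant.

(* K = I + k_p I + diag(k_{d,1}, ..., k_{d,m-1}, 0); the final zero is the
   default value of kd`_i when kd has size m - 1. *)
Definition gain_matrix {R : realType} (m : nat) (kp : R) (kd : seq R) :
    'M[R]_m :=
  1%:M + kp%:M + diag_mx (\row_(i < m) kd`_i).

(* Main.v *)
Require Import Defs.
From HB Require Import structures.
From mathcomp Require Import all_boot all_order all_algebra.
From mathcomp Require Import all_classical all_reals all_analysis.
From mathcomp Require Import measurable_realfun ring lra.
Import Order.TTheory GRing.Theory Num.Theory.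
Import numFieldNormedType.Exports.
Set Implicit Arguments.
Unset Strict Implicit.
Unset Printing Implicit Defensive.
Local Open Scope classical_set_scope.
Local Open Scope ring_scope.

(** The theorem is a Lyapunov argument for the energy
      V = 1/2 sum_i |e_i|^2 + 1/2 r^T M(X) r,
    which dominates a multiple of |z|^2 ([energy_coercive]).

    Since M g = D U, the filtered error satisfies
    M r' = N - e_n - 1/2 M' r - D U tau' ([open_loop]) with
    tau' = D K r + D C Sgn(e_n). In dV/dt, the chain e_1, ..., e_n dissipates a
    fixed fraction of its squared norm as soon as alpha >= 1/2
    ([error_chain_dissipation]). The matrix D U D is unit upper triangular, so
    the i-th component of r meets the gains K_j with j >= i only: k_p absorbs
    what is proportional to |r_i| |z|, and k_{d,i} absorbs the products r_i K_j r_j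
    with j > i. This is why the gains are chosen in succession
    ([regulation_dissipation]). There remains r_i (w_i - C_i Sgn(e_{n,i})) with
    |w_i| <= beta_i. It has no sign, but its integral is bounded by initial data:
    e_{n,i}' Sgn(e_{n,i}) integrates to |e_{n,i}|, and the bound on the integral of
    |e_{n,i}'| together with C_i >= beta_i (1 + gamma_2 / alpha_i) takes care of
    the rest ([energy_estimate]).

    These estimates hold inside a ball |z| <= Rb, where rho_N and rho_{i,j} are
    bounded. The control vanishes at t0, so the initial energy does not depend on
    the gains ([initial_jetE]): Rb is fixed first, then the gains, and a solution
    that reached the boundary of the ball would violate the energy estimate at
    the first such time ([zn_le]). Bounds on z give bounds on the jet of e_1 by
    triangularity ([jet_le_zvec]) and on tau by back substitution in U
    ([loop_control_bnd]). Finally |z|^2 is Lipschitz and integrable, hence tends to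
    zero ([barbalat]).

    Regularity needs care: Sgn(e_n) and x_r^(n+1) are only bounded and
    measurable, so tau, x^(n) and r are Lipschitz but differentiable only almost
    everywhere, and |e_{n,i}| has corners. The energy balance is therefore stated
    for left difference quotients at almost all times, and integrated by
    [lip_le_sint]. *)

(** * Bounded and Lipschitz functions *)

Section LipBnd.
Context {R : realType}.
Implicit Types (D : set R) (f g : R -> R).

Definition bnd D f := exists B, forall t, D t -> `|f t| <= B.

Definition lip D f := exists L, 0 <= L /\
  forall s t, D s -> D t -> `|f s - f t| <= L * `|s - t|.

Lemma bnd_sub D E f : E `<=` D -> bnd D f -> bnd E f.
Proof. by move=> ED [B HB]; exists B => t /ED; exact: HB. Qed.

Lemma lip_sub D E f : E `<=` D -> lip D f -> lip E f.
Proof. by move=> ED [L [L0 HL]]; exists L; split=> // s t /ED ? /ED ?; exact: HL. Qed.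

Lemma bnd_ge0 D f : bnd D f -> exists B, 0 <= B /\ forall t, D t -> `|f t| <= B.
Proof.
move=> [B HB]; exists `|B|; split=> // t /HB h.
exact: le_trans h (ler_norm _).
Qed.

Lemma eq_bnd D f g : (forall t, D t -> f t = g t) -> bnd D f -> bnd D g.
Proof. by move=> fg [B HB]; exists B => t Dt; rewrite -fg// HB. Qed.

Lemma eq_lip D f g : (forall t, D t -> f t = g t) -> lip D f -> lip D g.
Proof.
by move=> fg [L [L0 HL]]; exists L; split=> // s t Ds Dt; rewrite -!fg// HL.
Qed.

Lemma bnd_cst D (k : R) : bnd D (fun=> k).
Proof. by exists `|k|. Qed.

Lemma lip_cst D (k : R) : lip D (fun=> k).
Proof. by exists 0; split=> // s t _ _; rewrite subrr normr0 mul0r. Qed.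

Lemma bndD D f g : bnd D f -> bnd D g -> bnd D (fun t => f t + g t).
Proof.
move=> [B HB] [C HC]; exists (B + C) => t Dt.
by rewrite (le_trans (ler_normD _ _))// lerD ?HB ?HC.
Qed.

Lemma bndN D f : bnd D f -> bnd D (fun t => - f t).
Proof. by move=> [B HB]; exists B => t Dt; rewrite normrN HB. Qed.

Lemma bndM D f g : bnd D f -> bnd D g -> bnd D (fun t => f t * g t).
Proof.
move=> [B HB] [C HC]; exists (B * C) => t Dt.
by rewrite normrM ler_pM ?HB ?HC.
Qed.

Lemma bnd_sum D (I : Type) (r : seq I) (P : pred I) (f : I -> R -> R) :
  (forall i, P i -> bnd D (f i)) -> bnd D (fun t => \sum_(i <- r | P i) f i t).
Proof.
move=> H; elim: r => [|i r IH].
  by apply: eq_bnd (bnd_cst D 0) => t _; rewrite big_nil.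
have [Pi|Pi] := boolP (P i).
  by apply: eq_bnd (bndD (H _ Pi) IH) => t _; rewrite big_cons Pi.
by apply: eq_bnd IH => t _; rewrite big_cons (negbTE Pi).
Qed.

Lemma lipD D f g : lip D f -> lip D g -> lip D (fun t => f t + g t).
Proof.
move=> [L [L0 HL]] [M [M0 HM]]; exists (L + M); split; first exact: addr_ge0.
move=> s t Ds Dt; have -> : f s + g s - (f t + g t) = (f s - f t) + (g s - g t).
  by rewrite opprD addrACA.
by rewrite (le_trans (ler_normD _ _))// mulrDl lerD ?HL ?HM.
Qed.

Lemma lipN D f : lip D f -> lip D (fun t => - f t).
Proof.
move=> [L [L0 HL]]; exists L; split=> // s t Ds Dt.
by rewrite -opprD normrN HL.
Qed.

Lemma lipM D f g : bnd D f -> bnd D g -> lip D f -> lip D g ->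
  lip D (fun t => f t * g t).
Proof.
move=> /bnd_ge0[B [B0 HB]] /bnd_ge0[C [C0 HC]] [L [L0 HL]] [M [M0 HM]].
exists (L * C + B * M); split; first by rewrite addr_ge0// mulr_ge0.
move=> s t Ds Dt.
have -> : f s * g s - f t * g t = (f s - f t) * g s + f t * (g s - g t) by ring.
rewrite (le_trans (ler_normD _ _))// !normrM mulrDl lerD//.
  by rewrite mulrAC ler_pM ?HL ?HC.
by rewrite -mulrA ler_pM ?HM ?HB.
Qed.

Lemma lipZ D f (k : R) : lip D f -> lip D (fun t => k * f t).
Proof.
move=> [L [L0 HL]]; exists (`|k| * L); split; first exact: mulr_ge0.
by move=> s t Ds Dt; rewrite -mulrBr normrM -mulrA ler_wpM2l// HL.
Qed.

Lemma lip_sqr D f : bnd D f -> lip D f -> lip D (fun t => f t ^+ 2).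
Proof. by move=> bf lf; apply: eq_lip (lipM bf bf lf lf) => t _; rewrite expr2. Qed.

Lemma lip_norm D f : lip D f -> lip D (fun t => `|f t|).
Proof.
move=> [L [L0 HL]]; exists L; split=> // s t Ds Dt.
exact: le_trans (ler_dist_dist _ _) (HL _ _ Ds Dt).
Qed.

Lemma lip_sum D (I : Type) (r : seq I) (P : pred I) (f : I -> R -> R) :
  (forall i, P i -> lip D (f i)) -> lip D (fun t => \sum_(i <- r | P i) f i t).
Proof.
move=> H; elim: r => [|i r IH].
  by apply: eq_lip (lip_cst D 0) => t _; rewrite big_nil.
have [Pi|Pi] := boolP (P i).
  by apply: eq_lip (lipD (H _ Pi) IH) => t _; rewrite big_cons Pi.
by apply: eq_lip IH => t _; rewrite big_cons (negbTE Pi).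
Qed.

Lemma lip_bnd_itv D f (a b : R) : lip D f ->
  (forall t, D t -> a <= t <= b) -> bnd D f.
Proof.
move=> [L [L0 HL]] Dab; have [[t1 Dt1]|D0] := pselect (exists t, D t).
  exists (`|f t1| + L * (b - a)) => t Dt.
  have -> : f t = f t1 + (f t - f t1) by ring.
  rewrite (le_trans (ler_normD _ _))// lerD2l (le_trans (HL _ _ Dt Dt1))//.
  apply: ler_wpM2l => //; have := Dab t Dt; have := Dab t1 Dt1.
  move=> /andP[? ?] /andP[? ?]; rewrite ler_norml; apply/andP; split; lra.
by exists 0 => t Dt; exfalso; apply: D0; exists t.
Qed.

Lemma lip_continuous D f : lip D f -> {within D, continuous f}.
Proof.
move=> [L [L0 HL]]; apply/subspace_continuousP => t Dt.
apply/cvgrPdist_le => e e0.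
have d0 : 0 < e / (L + 1) by rewrite divr_gt0// ltr_wpDl.
rewrite near_withinE; near=> s => Ds.
apply: le_trans (HL _ _ Dt Ds) _.
have ts : `|t - s| <= e / (L + 1).
  by apply/ltW; near: s; exact: (@nbhsx_ballx R R t _ d0).
apply: le_trans (ler_wpM2l L0 ts) _.
by rewrite mulrCA ger_pMr// ler_pdivrMr ?mul1r ?lerDl// ltr_wpDl.
Unshelve. all: by end_near. Qed.

(** The point c is the infimum of the times at which f >= r. *)
Lemma first_time f a b r : a <= b -> lip `[a, b] f -> r <= f b ->
  exists c, [/\ a <= c <= b, r <= f c & forall s, a <= s -> s < c -> f s < r].
Proof.
move=> ab [L [L0 HL]] rfb.
pose A : set R := [set t | a <= t <= b /\ r <= f t].
have Ab : A b by rewrite /A /= lexx ab.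
have lbA : lbound A a by move=> t [/andP[]].
have infA : has_inf A by split; [exists b | exists a].
have ac : a <= inf A by apply: lb_le_inf => //; exists b.
have cb : inf A <= b by apply: ge_inf => //; exists a.
exists (inf A); split; first by rewrite ac cb.
- rewrite leNgt; apply/negP => fr.
  have d0 : 0 < (r - f (inf A)) / (L + 1).
    by rewrite divr_gt0// ?subr_gt0// ltr_wpDl.
  have [t [/andP[a_t tb] rt] td] := inf_adherent d0 infA.
  have ct : inf A <= t by apply: ge_inf; [exists a | rewrite /A /= a_t tb].
  have := HL t (inf A); rewrite /= !in_itv /= a_t tb ac cb => /(_ erefl erefl).
  rewrite (ger0_norm (x := t - _)) ?subr_ge0// => /(le_trans (ler_norm _)) h.
  have : L * (t - inf A) <= L * ((r - f (inf A)) / (L + 1)).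
    by apply: ler_wpM2l => //; rewrite lerBlDl ltW.
  have : L * ((r - f (inf A)) / (L + 1)) < r - f (inf A).
    rewrite mulrCA gtr_pMr ?subr_gt0// ltr_pdivrMr ?mul1r ?ltrDl//.
    by rewrite ltr_wpDl.
  lra.
- move=> s a_s sc; rewrite ltNge; apply/negP => rs.
  have : inf A <= s.
    apply: ge_inf; first by exists a.
    by split=> //; rewrite a_s (le_trans (ltW sc)).
  by rewrite leNgt sc.
Qed.

End LipBnd.

(** * Integrals and almost everywhere differential inequalities *)

Section Integral.
Context {R : realType}.
Local Notation mu := (@lebesgue_measure R).
Implicit Types (f g : R -> R) (a b c B : R).

Lemma aeS (P Q : R -> Prop) : (forall t, P t -> Q t) ->
  {ae mu, forall t, P t} -> {ae mu, forall t, Q t}.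
Proof. by move=> PQ; exact: (@filterS _ _ (ae_filter_ringOfSetsType mu)). Qed.

Lemma aeI (P Q : R -> Prop) : {ae mu, forall t, P t} ->
  {ae mu, forall t, Q t} -> {ae mu, forall t, P t /\ Q t}.
Proof. exact: (@filterI _ _ (ae_filter_ringOfSetsType mu)). Qed.

Lemma mu_itvcc a b : a <= b -> mu `[a, b] = (b - a)%:E.
Proof.
move=> ab; rewrite lebesgue_measure_itv /= lte_fin EFinB.
case: ltgtP ab => // -> _.
by rewrite -EFinB subrr.
Qed.

Lemma ae_bounded_integrable f a b B : measurable_fun `[a, b] f ->
  {ae mu, forall t, `[a, b]%classic t -> `|f t| <= B} ->
  mu.-integrable `[a, b] (EFin \o f).
Proof.
move=> mf bf; apply/integrableP; split; first exact/measurable_EFinP.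
apply: le_lt_trans.
  apply: (integral_le_bound `|B|%:E) => //.
  - exact/measurable_EFinP.
  - apply: aeS bf => t bt It /=; rewrite lee_fin.
    exact: le_trans (bt It) (ler_norm _).
have muab : (mu `[a, b] < +oo)%E.
  rewrite lebesgue_measure_itv /=; case: ifP => _; last exact: ltry.
  by rewrite -EFinB ltry.
by rewrite lte_mul_pinfty.
Qed.

Lemma sint_ae_bound f a b B : a <= b -> measurable_fun `[a, b] f -> 0 <= B ->
  {ae mu, forall t, `[a, b]%classic t -> `|f t| <= B} ->
  `|sint a b f| <= B * (b - a).
Proof.
move=> ab mf B0 bf.
rewrite -lee_fin EFin_normr_Rintegral//; last exact: ae_bounded_integrable bf.
have mfE : measurable_fun `[a, b] (EFin \o f) by exact/measurable_EFinP.
apply: (le_trans (le_abse_integral mu (measurable_itv _) mfE)).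
apply: le_trans.
  apply: (integral_le_bound B%:E) => //.
by rewrite EFinM -(mu_itvcc ab).
Qed.

Lemma sintB f a b c : mu.-integrable `[a, c] (EFin \o f) -> a <= b -> b <= c ->
  sint a c f - sint a b f = sint b c f.
Proof.
move=> fi ab bc; rewrite /sint Rintegral_itvB//.
rewrite Rintegral_itv_obnd_cbnd//; apply: integrableS fi => //.
by apply: subset_itvr; rewrite bnd_simp.
Qed.

Lemma sint_lip f a b B : a <= b -> measurable_fun `[a, b] f -> 0 <= B ->
  {ae mu, forall t, `[a, b]%classic t -> `|f t| <= B} ->
  forall s t, `[a, b]%classic s -> `[a, b]%classic t ->
  `|sint a s f - sint a t f| <= B * `|s - t|.
Proof.
move=> ab mf B0 bf s t; wlog st : s t / s <= t.
  move=> H Is It; have [/H|/ltW/H] := leP s t; first exact.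
  by move=> /(_ It Is); rewrite distrC [X in _ * X]distrC.
rewrite /= !in_itv /= => /andP[a_s sb] /andP[a_t tb].
have mst : measurable_fun `[a, t] f.
  by apply: measurable_funS mf => //; apply: subset_itvl; rewrite bnd_simp.
have bst : {ae mu, forall u, `[a, t]%classic u -> `|f u| <= B}.
  apply: aeS bf => u bu Iu; apply: bu; apply: subset_itvl Iu.
  by rewrite bnd_simp.
rewrite distrC [X in _ * X]distrC sintB//; last exact: ae_bounded_integrable bst.
rewrite (ger0_norm (x := t - s)) ?subr_ge0//.
apply: sint_ae_bound => //.
  by apply: measurable_funS mst => //; apply: subset_itvr; rewrite bnd_simp.
by apply: aeS bst => u bu Iu; apply: bu; apply: subset_itvr Iu; rewrite bnd_simp.
Qed.

Lemma sint_derive_ae f a b B : measurable_fun `[a, b] f ->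
  {ae mu, forall t, `[a, b]%classic t -> `|f t| <= B} ->
  {ae mu, forall t, a < t -> t < b -> is_derive t 1 (sint a ^~ f) (f t)}.
Proof.
move=> mf bf.
have fi := ae_bounded_integrable mf bf.
pose g := f \_ `[a, b].
have gi : mu.-integrable setT (EFin \o g).
  by rewrite /g -restrict_EFin; apply/integrable_restrict => //; rewrite setTI.
have gl : locally_integrable setT g by exact: integrable_locally.
have giy y : mu.-integrable `[a, y] (EFin \o g) by apply: integrableS gi.
have gFTC := FTC1 giy gl.
apply: aeS gFTC => t Ht a_t tb.
case: Ht => [|dg]; first by rewrite lte_fin.
have -> : g t = f t by rewrite /g patchE mem_set//= in_itv/= !ltW.
move=> dgE.
apply: (@near_eq_is_derive _ _ _ (fun x => \int[mu]_(t in `[a, x]) g t)); last first.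
  by apply: DeriveDef; [exact: dg|rewrite -dgE derive1E].
near=> s; apply: eq_Rintegral => u; rewrite inE /= in_itv /= => /andP[au us].
rewrite /g patchE mem_set//= in_itv /= au (le_trans us)//.
by apply: ltW; near: s; exact: lt_nbhsl.
Unshelve. all: by end_near. Qed.

Lemma sint_derive f a b t : a < t -> t < b -> {within `[a, b], continuous f} ->
  is_derive t 1 (sint a ^~ f) (f t).
Proof.
move=> a_t tb cf.
have fi : mu.-integrable `[a, b] (EFin \o f).
  by apply: continuous_compact_integrable => //; exact: segment_compact.
have ft : {for t, continuous f}.
  apply: (within_continuous_continuous (lt_trans a_t tb) cf).
  by rewrite in_itv /= a_t.
have [d dE] := continuous_FTC1_closed tb fi a_t ft.
by apply: DeriveDef; [exact: d|rewrite -dE derive1E].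
Qed.

(** First-order expansion at the left of t, in the form that the comparison
    lemmas below consume. *)
Lemma is_derive_left (G : R -> R) (t l : R) : is_derive t (1 : R) G l ->
  forall e, 0 < e ->
  \forall s \near t^'-, `|G t - G s - l * (t - s)| <= e * (t - s).
Proof.
move=> [/cvg_ex[k Gk] Gl] e e0.
have kl : k = l by rewrite -Gl; apply/esym/cvg_lim => //; exact: Gk.
move: Gk; rewrite kl => /cvgrPdist_le/(_ e e0) /nbhs_ballP[d /= d0 H].
apply/nbhs_ballP; exists d => //= s; rewrite /ball /= => sd st.
have st0 : t - s != 0 by rewrite subr_eq0 gt_eqF.
have := H (s - t); rewrite /ball /= sub0r opprB => /(_ sd).
rewrite subr_eq0 lt_eqF// => /(_ erefl).
rewrite /GRing.scale /= mulr1 subrK => h.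
have -> : G t - G s - l * (t - s) = - (l - (s - t)^-1 * (G s - G t)) * (t - s).
  by rewrite -(opprB t s) invrN; field.
by rewrite normrM normrN [X in _ * X]gtr0_norm ?subr_gt0// ler_wpM2r// subr_ge0 ltW.
Qed.

(** Cover the null set of bad times by an open set Q of small measure, and let
    phi t be the measure of Q before t. Subtracting L phi makes f nonincreasing
    to the left of the bad times too, since there phi has slope 1 and L is a
    Lipschitz constant of f; then [first_time] excludes any increase. *)
Lemma lip_nonincreasing (f : R -> R) a b : a <= b -> lip `[a, b] f ->
  {ae mu, forall t, a < t -> t < b -> forall e, 0 < e ->
    \forall s \near t^'-, f t - f s <= e * (t - s)} ->
  f b <= f a.
Proof.
move=> ab lf [A [mA A0 NA]]; apply/ler_addgt0Pr => e e0.
have [L [L0 HL]] := lf.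
pose eta := e / (2 * ((b - a) + 1)).
pose del := e / (2 * (L + 1)).
have ba0 : 0 < b - a + 1 by rewrite ltr_wpDl// subr_ge0.
have L10 : 0 < L + 1 by rewrite ltr_wpDl.
have eta0 : 0 < eta by rewrite divr_gt0// mulr_gt0.
have del0 : 0 < del by rewrite divr_gt0// mulr_gt0.
(* b is put among the bad times since nothing is assumed there *)
pose A1 := A `|` [set b].
have mA1 : measurable A1 by apply: measurableU.
have A10 : mu A1 = 0%E.
  apply/eqP; rewrite eq_le measure_ge0 andbT.
  apply: (le_trans (measureU2 _ mA (measurable_set1 b))).
  have b0 : mu [set b] = 0%E by exact: lebesgue_measure_set1.
  by rewrite [X in (X + _)%E]A0 [X in (_ + X)%E]b0 add0e.
have Afin : (mu A1 < +oo)%E by rewrite A10 ltry.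
have [Q [oO AO muO]] := lebesgue_regularity_outer mA1 Afin del0.
have mO : measurable Q by exact: open_measurable.
have muOd : (mu Q < del%:E)%E.
  rewrite -(setDUK AO).
  apply: (le_lt_trans (measureU2 _ mA1 (measurableD mO mA1))).
  by rewrite [X in (X + _)%E]A10 add0e.
pose I : R -> R := \1_Q.
have mI E : measurable_fun E I by exact: measurable_indic.
have bI c : {ae mu, forall t, `[a, c]%classic t -> `|I t| <= 1}.
  apply: aeW => t _; rewrite /I indicE ger0_norm ?ler0n//.
  by case: (_ \in _); rewrite ?ler01.
have iI c : mu.-integrable `[a, c] (EFin \o I) by exact: ae_bounded_integrable (bI c).
pose phi t := sint a t I.
have phi_lip : lip `[a, b] phi.
  exists 1; split=> //; exact: sint_lip.
have phi_ge s t : a <= s -> s <= t -> phi s <= phi t.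
  move=> as_ st; rewrite -subr_ge0 sintB//.
  by apply: Rintegral_ge0 => u _; rewrite /I indicE ler0n.
have phi_O s t : a <= s -> s <= t -> `[s, t] `<=` Q -> phi t - phi s = t - s.
  move=> as_ st stQ; rewrite sintB//.
  have -> : sint s t I = sint s t (fun=> 1).
    by apply: eq_Rintegral => u /set_mem/stQ Ou; rewrite /I indicE mem_set.
  rewrite /sint Rintegral_cst// mul1r; exact: (congr1 fine (mu_itvcc st)).
have phi_b : phi b <= del.
  rewrite /phi /sint /Rintegral /I.
  rewrite integral_indic//.
  have OI : (mu (Q `&` `[a, b]) < del%:E)%E.
    apply: le_lt_trans muOd; apply: le_measure; rewrite ?inE//.
    exact: measurableI.
  rewrite -lee_fin fineK ?(ltW OI)// ge0_fin_numE//.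
  exact: lt_trans OI (ltry _).
have phi_a : 0 <= phi a by apply: Rintegral_ge0 => u _; rewrite /I indicE ler0n.
(* the slope - eta makes the decrease strict *)
pose W t := f t + - L * phi t + - eta * (t - a).
have Wlip : lip `[a, b] W.
  have [M [M0 HM]] := phi_lip.
  exists (L + L * M + eta); split.
    by apply: addr_ge0; [apply: addr_ge0 => //; exact: mulr_ge0|exact: ltW].
  move=> s t Is It; rewrite /W.
  have -> : f s + - L * phi s + - eta * (s - a) -
    (f t + - L * phi t + - eta * (t - a)) =
    (f s - f t) - L * (phi s - phi t) - eta * (s - t) by ring.
  rewrite (le_trans (ler_normB _ _))// mulrDl lerD//; last first.
    by rewrite normrM gtr0_norm.
  rewrite (le_trans (ler_normB _ _))// mulrDl lerD ?HL//.
  by rewrite normrM ger0_norm// -mulrA ler_wpM2l// HM.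
have [c [/andP[ac cb] Wbc Hc]] := first_time ab Wlip (lexx (W b)).
have Lb : L * phi b <= e / 2.
  apply: le_trans (ler_wpM2l L0 phi_b) _.
  have -> : L * del = e / 2 * (L / (L + 1)) by rewrite /del; field; exact: lt0r_neq0.
  by rewrite ler_piMr ?divr_ge0 ?(ltW e0)// ler_pdivrMr// mul1r lerDl.
have etab : eta * (b - a) <= e / 2.
  have -> : eta * (b - a) = e / 2 * ((b - a) / (b - a + 1)).
    by rewrite /eta; field; exact: lt0r_neq0.
  by rewrite ler_piMr ?divr_ge0 ?(ltW e0)// ler_pdivrMr// mul1r lerDl.
have [ac1|ac1] := leP c a.
  have ca : c = a by apply/eqP; rewrite eq_le ac1 ac.
  move: Wbc; rewrite ca /W subrr mulr0.
  have := mulr_ge0 L0 phi_a; lra.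
exfalso; have [Ac|Ac] := pselect (A1 c).
  have Oc : nbhs c Q by apply: open_nbhs_nbhs; split=> //; exact: AO.
  have [d /= d0 Hd] := Oc.
  pose s := Num.max a (c - d / 2).
  have d20 : 0 < d / 2 by rewrite divr_gt0.
  have d2d : d / 2 < d by rewrite ltr_pdivrMr// ltr_pMr// ltr1n.
  have as_ : a <= s by rewrite le_max lexx.
  have sc : s < c by rewrite gt_max ac1 ltrBlDr ltrDl.
  have scO : `[s, c] `<=` Q.
    move=> u; rewrite /= in_itv /= => /andP[su uc]; apply: Hd.
    have : c - d / 2 <= s by rewrite le_max lexx orbT.
    rewrite /ball_ /= ger0_norm ?subr_ge0//; lra.
  have := Hc s as_ sc; have := HL c s; rewrite /= !in_itv /= ac cb as_.
  rewrite (ltW (lt_le_trans sc cb)) => /(_ erefl erefl).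
  rewrite (ger0_norm (x := c - s)) ?subr_ge0 ?(ltW sc)//.
  move=> /(le_trans (ler_norm _)) fcs.
  have := phi_O s c as_ (ltW sc) scO.
  have : 0 < eta * (c - s) by rewrite mulr_gt0// subr_gt0.
  move=> h1 h2 h3; have : L * (phi c - phi s) = L * (c - s) by rewrite h2.
  by move: Wbc h3; rewrite /W; lra.
have cb1 : c < b.
  rewrite lt_neqAle cb andbT; apply/eqP => cbE; apply: Ac; right; exact: cbE.
have Pc : forall e, 0 < e -> \forall s \near c^'-, f c - f s <= e * (c - s).
  by apply: contrapT => nP; apply: Ac; left; apply: NA => /= /(_ ac1 cb1).
have : \forall s \near c^'-, False; last by move/filter_ex => [].
near=> s.
have as_ : a < s by near: s; exact: nbhs_left_gt.
have sc : s < c by near: s; exact: nbhs_left_lt.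
have fs : f c - f s <= eta * (c - s) by near: s; exact: Pc.
have := Hc s (ltW as_) sc; move: Wbc; rewrite /W.
have := phi_ge s c (ltW as_) (ltW sc); rewrite -subr_ge0 => /(mulr_ge0 L0).
lra.
Unshelve. all: by end_near. Qed.

(** One half of the fundamental theorem of calculus for Lipschitz functions. Only
    an upper bound on left difference quotients at almost all times is required:
    this suits |e_{n,i}|, which need not be differentiable. *)
Lemma lip_le_sint (f g : R -> R) a b : a <= b -> lip `[a, b] f ->
  {within `[a, b], continuous g} ->
  {ae mu, forall t, a < t -> t < b -> forall e, 0 < e ->
    \forall s \near t^'-, f t - f s <= (g t + e) * (t - s)} ->
  f b - f a <= sint a b g.
Proof.
move=> ab lf cg H.
have [B Bg] : bnd `[a, b] g.
  have /compact_bounded[M [_ HM]] := continuous_compact cg (@segment_compact R a b).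
  by exists (M + 1) => t It; apply: (HM (M + 1)); rewrite ?ltrDl//; exists t.
have [B0 [B00 B0g]] := bnd_ge0 (ex_intro _ B Bg).
have mg : measurable_fun `[a, b] g by exact: subspace_continuous_measurable_fun.
have lG : lip `[a, b] (sint a ^~ g).
  exists B0; split=> //; apply: sint_lip => //.
  exact: aeW.
have := @lip_nonincreasing (fun t => f t - sint a t g) a b ab (lipD lf (lipN lG)).
rewrite /= [sint a a g]/sint set_itv1 Rintegral_set1 subr0 lerBlDr -lerBlDl; apply.
apply: aeS H => t Ht a_t tb e e0.
have e20 : 0 < e / 2 by rewrite divr_gt0.
near=> s.
have h1 : f t - f s <= (g t + e / 2) * (t - s) by near: s; exact: Ht.
have : `|sint a t g - sint a s g - g t * (t - s)| <= e / 2 * (t - s).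
  near: s; apply: is_derive_left => //; exact: sint_derive a_t tb cg.
by move=> /ler_normlP[]; lra.
Unshelve. all: by end_near. Qed.

End Integral.

(** * Matrix-valued curves *)

Section MatrixCurves.
Context {R : realType}.
Implicit Types (t : R) (D : set R).

Lemma mx_cvg (T : Type) (F : set_system T) (FF : Filter F) p q
    (A : T -> 'M[R]_(p, q)) (L : 'M[R]_(p, q)) :
  (forall i j, A x i j @[x --> F] --> L i j) -> A x @[x --> F] --> L.
Proof.
move=> H; apply/cvgrPdist_le => /= e e0; near=> x.
rewrite /Num.Def.normr/= mx_normrE (bigmax_le _ (ltW e0))//= => i _.
rewrite !mxE/=; move: i; near: x; apply: filter_forall => /= i.
exact: ((cvgrPdist_le _ _).1 (H i.1 i.2)).
Unshelve. all: by end_near. Qed.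

Lemma mx_cvg_entry (T : Type) (F : set_system T) (FF : Filter F) p q
    (A : T -> 'M[R]_(p, q)) (L : 'M[R]_(p, q)) i j :
  A x @[x --> F] --> L -> A x i j @[x --> F] --> L i j.
Proof. by move=> H; exact: (cvg_comp _ _ H (@coord_continuous _ _ _ i j L)). Qed.

(** Boundedness, Lipschitz continuity and differentiability are imposed entry by
    entry, which reduces the rules for matrix products to those of real
    functions. *)
Definition mbnd D p q (A : R -> 'M[R]_(p, q)) :=
  forall i j, bnd D (fun t => A t i j).
Definition mlip D p q (A : R -> 'M[R]_(p, q)) :=
  forall i j, lip D (fun t => A t i j).
Definition mder p q (A : R -> 'M[R]_(p, q)) t (A' : 'M[R]_(p, q)) :=
  forall i j, is_derive t (1 : R) (fun s => A s i j) (A' i j).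

Lemma mlip_continuous D p q (A : R -> 'M[R]_(p, q)) :
  mlip D A -> {within D, continuous A}.
Proof.
move=> lA; apply/subspace_continuousP => t Dt; apply: mx_cvg => i j.
by have /subspace_continuousP := lip_continuous (lA i j); exact.
Qed.

Lemma is_derive_ext (f g : R -> R) t l k : is_derive t (1 : R) f l ->
  f =1 g -> l = k -> is_derive t (1 : R) g k.
Proof. by move=> df /funext <- <-. Qed.

Lemma is_derive_sumf (I : Type) (r : seq I) (P : pred I) (f : I -> R -> R)
    (f' : I -> R) t :
  (forall i, P i -> is_derive t (1 : R) (f i) (f' i)) ->
  is_derive t (1 : R) (fun s => \sum_(i <- r | P i) f i s) (\sum_(i <- r | P i) f' i).
Proof.
move=> H; elim: r => [|i r IH].
  by apply: (is_derive_ext (is_derive_cst (0 : R) t 1)) => [s|]; rewrite big_nil.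
have [Pi|Pi] := boolP (P i).
  have dP := H _ Pi.
  apply: (is_derive_ext (is_deriveD dP IH)) => [s|]; rewrite big_cons Pi//.
by apply: (is_derive_ext IH) => [s|]; rewrite big_cons (negbTE Pi).
Qed.

Lemma is_derive_mul (f g : R -> R) t f' g' : is_derive t (1 : R) f f' ->
  is_derive t (1 : R) g g' ->
  is_derive t (1 : R) (fun s => f s * g s) (f' * g t + f t * g').
Proof.
move=> df dg; apply: (is_derive_ext (is_deriveM df dg)) => //.
by rewrite /GRing.scale /=; ring.
Qed.

Lemma mder_cst p q (A : 'M[R]_(p, q)) t : mder (fun=> A) t 0.
Proof. by move=> i j; rewrite mxE; exact: is_derive_cst. Qed.

Lemma mderD p q (A B : R -> 'M[R]_(p, q)) t A' B' : mder A t A' -> mder B t B' ->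
  mder (fun s => A s + B s) t (A' + B').
Proof.
move=> dA dB i j; apply: (is_derive_ext (is_deriveD (dA i j) (dB i j))).
  by move=> s; rewrite mxE.
by rewrite mxE.
Qed.

Lemma mderN p q (A : R -> 'M[R]_(p, q)) t A' : mder A t A' ->
  mder (fun s => - A s) t (- A').
Proof.
move=> dA i j; apply: (is_derive_ext (is_deriveN (dA i j))).
  by move=> s; rewrite mxE.
by rewrite mxE.
Qed.

Lemma mderB p q (A B : R -> 'M[R]_(p, q)) t A' B' : mder A t A' -> mder B t B' ->
  mder (fun s => A s - B s) t (A' - B').
Proof. by move=> dA dB; apply: mderD => //; exact: mderN. Qed.

Lemma mderZ p q (A : R -> 'M[R]_(p, q)) t A' (k : R) : mder A t A' ->
  mder (fun s => k *: A s) t (k *: A').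
Proof.
move=> dA i j; apply: (is_derive_ext (is_derive_mul (is_derive_cst k t 1) (dA i j))).
  by move=> s; rewrite mxE.
by rewrite mxE mul0r add0r.
Qed.

Lemma mderM p q r (A : R -> 'M[R]_(p, q)) (B : R -> 'M[R]_(q, r)) t A' B' :
  mder A t A' -> mder B t B' ->
  mder (fun s => A s *m B s) t (A' *m B t + A t *m B').
Proof.
move=> dA dB i j.
have dk k := is_derive_mul (dA i k) (dB k j).
apply: (is_derive_ext (@is_derive_sumf _ (index_enum _) predT _ _ t (fun k _ => dk k))).
  by move=> s; rewrite mxE.
by rewrite !mxE -big_split.
Qed.

Lemma mderMl p q r (A : 'M[R]_(p, q)) (B : R -> 'M[R]_(q, r)) t B' :
  mder B t B' -> mder (fun s => A *m B s) t (A *m B').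
Proof. by move=> dB; have := mderM (mder_cst A t) dB; rewrite mul0mx add0r. Qed.

Lemma mder_tr p q (A : R -> 'M[R]_(p, q)) t A' :
  mder A t A' -> mder (fun s => (A s)^T) t A'^T.
Proof.
by move=> dA i j; apply: (is_derive_ext (dA j i)) => [s|]; rewrite mxE.
Qed.

Lemma mder_near p q (A B : R -> 'M[R]_(p, q)) t A' :
  (\forall s \near t, A s = B s) -> mder A t A' -> mder B t A'.
Proof.
move=> AB dA i j; apply: near_eq_is_derive (dA i j).
by near=> s; rewrite (near AB s).
Unshelve. all: by end_near. Qed.

Lemma mder_sum (I : Type) (r : seq I) (P : pred I) p q
    (A : I -> R -> 'M[R]_(p, q)) A' t :
  (forall i, P i -> mder (A i) t (A' i)) ->
  mder (fun s => \sum_(i <- r | P i) A i s) t (\sum_(i <- r | P i) A' i).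
Proof.
move=> H i j.
have dk k (Pk : P k) := H k Pk i j.
apply: (is_derive_ext (@is_derive_sumf _ r P _ _ t dk)).
  by move=> s; rewrite summxE.
by rewrite summxE.
Qed.

(** Entrywise derivatives are derivatives for the normed module of matrices; this
    gives access to the chain rule. *)
Lemma mderP p q (A : R -> 'M[R]_(p, q)) t A' :
  mder A t A' <-> is_derive t (1 : R) A A'.
Proof.
split=> [dA|dA i j].
  have dd : derivable A t 1 by apply/derivable_mxP => i j; have [] := dA i j.
  apply: DeriveDef => //; rewrite derive_mx//; apply/matrixP => i j.
  by rewrite mxE; apply: derive_val.
have [dd <-] := dA; rewrite derive_mx// mxE.
by apply: DeriveDef => //; move: dd => /derivable_mxP.
Qed.

Lemma mder_comp p q p' q' (F : 'M[R]_(p, q) -> 'M[R]_(p', q'))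
    (X : R -> 'M[R]_(p, q)) t X' :
  mder X t X' -> differentiable F (X t) ->
  mder (fun s => F (X s)) t ('d F (X t) X').
Proof.
move=> /mderP[dX <-] dF; apply/mderP.
have dX1 : differentiable X t by apply/derivable1_diffP.
have dc : differentiable (F \o X) t by exact: differentiable_comp.
apply: DeriveDef; first by apply/derivable1_diffP.
by rewrite deriveE// diff_comp//= deriveE.
Qed.

Lemma mbndD D p q (A B : R -> 'M[R]_(p, q)) : mbnd D A -> mbnd D B ->
  mbnd D (fun s => A s + B s).
Proof.
move=> a b i j; apply: eq_bnd (bndD (a i j) (b i j)) => t _; by rewrite mxE.
Qed.

Lemma mlipD D p q (A B : R -> 'M[R]_(p, q)) : mlip D A -> mlip D B ->
  mlip D (fun s => A s + B s).
Proof.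
move=> a b i j; apply: eq_lip (lipD (a i j) (b i j)) => t _; by rewrite mxE.
Qed.

Lemma mbndN D p q (A : R -> 'M[R]_(p, q)) : mbnd D A -> mbnd D (fun s => - A s).
Proof.
move=> a i j; apply: eq_bnd (bndN (a i j)) => t _; by rewrite mxE.
Qed.

Lemma mlipN D p q (A : R -> 'M[R]_(p, q)) : mlip D A -> mlip D (fun s => - A s).
Proof.
move=> a i j; apply: eq_lip (lipN (a i j)) => t _; by rewrite mxE.
Qed.

Lemma mbnd_cst D p q (A : 'M[R]_(p, q)) : mbnd D (fun=> A).
Proof. by move=> i j; exact: bnd_cst. Qed.

Lemma mlip_cst D p q (A : 'M[R]_(p, q)) : mlip D (fun=> A).
Proof. by move=> i j; exact: lip_cst. Qed.

Lemma mbndM D p q r (A : R -> 'M[R]_(p, q)) (B : R -> 'M[R]_(q, r)) :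
  mbnd D A -> mbnd D B -> mbnd D (fun s => A s *m B s).
Proof.
move=> a b i j; apply: eq_bnd (bnd_sum _ (fun k _ => bndM (a i k) (b k j))) => t _.
by rewrite mxE.
Qed.

Lemma mlipM D p q r (A : R -> 'M[R]_(p, q)) (B : R -> 'M[R]_(q, r)) :
  mbnd D A -> mbnd D B -> mlip D A -> mlip D B -> mlip D (fun s => A s *m B s).
Proof.
move=> a b la lb i j.
apply: eq_lip (lip_sum _ (fun k _ => lipM (a i k) (b k j) (la i k) (lb k j))) => t _.
by rewrite mxE.
Qed.

Lemma mbnd_sum D p q (I : Type) (r : seq I) (P : pred I) (A : I -> R -> 'M[R]_(p, q)) :
  (forall i, P i -> mbnd D (A i)) -> mbnd D (fun t => \sum_(i <- r | P i) A i t).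
Proof.
move=> H i j; apply: eq_bnd (bnd_sum _ (fun k Pk => H k Pk i j)) => t _.
by rewrite summxE.
Qed.

Lemma mlip_sum D p q (I : Type) (r : seq I) (P : pred I) (A : I -> R -> 'M[R]_(p, q)) :
  (forall i, P i -> mlip D (A i)) -> mlip D (fun t => \sum_(i <- r | P i) A i t).
Proof.
move=> H i j; apply: eq_lip (lip_sum _ (fun k Pk => H k Pk i j)) => t _.
by rewrite summxE.
Qed.

Lemma mbndZ D p q (A : R -> 'M[R]_(p, q)) (k : R) :
  mbnd D A -> mbnd D (fun s => k *: A s).
Proof.
move=> a i j; apply: eq_bnd (bndM (bnd_cst D k) (a i j)) => t _; by rewrite mxE.
Qed.

Lemma mlipZ D p q (A : R -> 'M[R]_(p, q)) (k : R) :
  mlip D A -> mlip D (fun s => k *: A s).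
Proof.
by move=> a i j; apply: eq_lip (lipZ k (a i j)) => t _; rewrite mxE.
Qed.

Lemma mlipMl D p q r (A : 'M[R]_(p, q)) (B : R -> 'M[R]_(q, r)) :
  mlip D B -> mlip D (fun t => A *m B t).
Proof.
move=> lB i j; apply: (@eq_lip _ _ (fun t => \sum_k A i k * B t k j)).
  by move=> t _; rewrite mxE.
by apply: lip_sum => k _; apply: lipZ; exact: lB.
Qed.

Lemma mbnd_sub D D' p q (A : R -> 'M[R]_(p, q)) : D' `<=` D -> mbnd D A -> mbnd D' A.
Proof. by move=> DD H i j; exact: bnd_sub (H i j). Qed.

Lemma mlip_sub D D' p q (A : R -> 'M[R]_(p, q)) : D' `<=` D -> mlip D A -> mlip D' A.
Proof. by move=> DD H i j; exact: lip_sub (H i j). Qed.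

Lemma mlip_bnd_itv D p q (A : R -> 'M[R]_(p, q)) (a b : R) : mlip D A ->
  (forall t, D t -> a <= t <= b) -> mbnd D A.
Proof. by move=> lA Dab i j; exact: lip_bnd_itv (lA i j) Dab. Qed.

Lemma eq_mbnd D p q (A B : R -> 'M[R]_(p, q)) :
  (forall t, D t -> A t = B t) -> mbnd D A -> mbnd D B.
Proof. by move=> AB a i j; apply: eq_bnd (a i j) => t /AB ->. Qed.

Lemma eq_mlip D p q (A B : R -> 'M[R]_(p, q)) :
  (forall t, D t -> A t = B t) -> mlip D A -> mlip D B.
Proof. by move=> AB a i j; apply: eq_lip (a i j) => t /AB ->. Qed.

Lemma vec_mx_continuous p q : continuous (@vec_mx R p q).
Proof.
move=> v; apply: (@mx_cvg _ (nbhs v) _ p q (@vec_mx R p q)) => i j.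
have -> : (fun x : 'rV[R]_(p * q) => vec_mx x i j) =
    (fun x => x 0 (mxvec_index i j)) by apply/funext => x; rewrite mxE.
rewrite mxE; exact: (@coord_continuous _ _ _ 0 (mxvec_index i j) v).
Qed.

(** A box of matrices is compact, as the image by [vec_mx] of a box of row
    vectors. *)
Lemma comp_bnd D p q (X : R -> 'M[R]_(p, q)) (G : 'M[R]_(p, q) -> R) :
  continuous G -> mbnd D X -> bnd D (fun t => G (X t)).
Proof.
move=> cG bX.
have [B HB] : exists B, forall i j t, D t -> `|X t i j| <= B.
  have [B HB] := choice (fun ij : 'I_p * 'I_q => bX ij.1 ij.2).
  exists (\sum_ij `|B ij|) => i j t Dt.
  apply: le_trans (HB (i, j) t Dt) _; apply: le_trans (ler_norm _) _.
  by rewrite (bigD1 (i, j))//= lerDl sumr_ge0.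
pose K := [set v : 'rV[R]_(p * q) | forall i, `[- B, B]%classic (v ord0 i)].
have cK : compact K by apply: (@rV_compact _ _ (fun=> _)) => _; exact: segment_compact.
have cGK : compact ((G \o vec_mx) @` K).
  apply: continuous_compact => //; apply: continuous_subspaceT => v.
  by apply: continuous_comp; [exact: vec_mx_continuous|exact: cG].
have /compact_bounded[M [_ HM]] := cGK.
exists (M + 1) => t Dt; apply: (HM (M + 1)); first by rewrite ltrDl.
exists (mxvec (X t)); last by rewrite /= mxvecK.
move=> k; case/mxvec_indexP: k => i j; rewrite mxvecE /= in_itv /= -ler_norml.
exact: HB.
Qed.

Lemma C1_continuous p q p' q' (F : 'M[R]_(p, q) -> 'M[R]_(p', q')) :
  C1 F -> continuous F.
Proof. by move=> [dF _] X; apply: differentiable_continuous. Qed.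

Lemma mcomp_bnd D p q p' q' (X : R -> 'M[R]_(p, q))
    (F : 'M[R]_(p, q) -> 'M[R]_(p', q')) :
  continuous F -> mbnd D X -> mbnd D (fun t => F (X t)).
Proof.
move=> cF bX i j; apply: (comp_bnd (G := fun X => F X i j)) => // Y.
exact: mx_cvg_entry (cF Y).
Qed.

(** Linearity in the direction reduces the claim to the directions
    [delta_mx k l], for which C1 gives continuity of the differential in X. *)
Lemma diff_bnd D p q p' q' (X X' : R -> 'M[R]_(p, q))
    (F : 'M[R]_(p, q) -> 'M[R]_(p', q')) :
  C1 F -> mbnd D X -> mbnd D X' -> mbnd D (fun t => 'd F (X t) (X' t)).
Proof.
move=> [dF cF] bX bX' i j.
have E t : 'd F (X t) (X' t) i j =
    \sum_k \sum_l X' t k l * ('d F (X t) (delta_mx k l) : 'M[R]_(p', q')) i j.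
  rewrite [X' t in LHS]matrix_sum_delta linear_sum summxE.
  apply: eq_bigr => k _; rewrite linear_sum summxE; apply: eq_bigr => l _.
  by rewrite linearZ mxE.
apply: (eq_bnd (fun t _ => esym (E t))).
apply: bnd_sum => k _; apply: bnd_sum => l _; apply: bndM; first exact: bX'.
apply: (comp_bnd (G := fun Y => ('d F Y (delta_mx k l) : 'M[R]_(p', q')) i j)) => // Y.
exact: mx_cvg_entry (cF _ Y).
Qed.

End MatrixCurves.

Section Backsubstitution.
Context {R : realType} {m : nat}.

(** The inverse of A t is not formed: the entries of v are bounded from the last
    one to the first. *)
Lemma backsubst_bnd (D : set R) (A : R -> 'M[R]_m) (v : R -> 'cV[R]_m) :
  (forall t, D t -> unit_upper_triangular (A t)) -> mbnd D A ->
  mbnd D (fun t => A t *m v t) -> mbnd D v.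
Proof.
move=> uA bA bAv.
suff H k : forall i : 'I_m, (m - i <= k)%N -> bnd D (fun t => v t i 0).
  by move=> i j; rewrite ord1; exact: H (leqnn _).
elim: k => [|k IH] i hi.
  by have := ltn_ord i; rewrite -subn_gt0 lt0n -leqn0 hi.
apply: (@eq_bnd _ _ (fun t => (A t *m v t) i 0 + - \sum_(j < m | (i < j)%N) A t i j * v t j 0)).
  move=> t Dt; have [U0 U1] := uA t Dt.
  rewrite mxE (bigD1 i)//= U1 mul1r [X in _ + X - _](bigID (fun j : 'I_m => (i < j)%N)) /=.
  rewrite [X in _ + (_ + X) - _]big1 ?addr0.
    rewrite (eq_bigl (fun j : 'I_m => (i < j)%N)) ?addrK// => j.
    by case: ltngtP => //; rewrite ?andbT ?andbF// => ij; rewrite -val_eqE /= ?gtn_eqF.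
  move=> j /andP[ji]; rewrite -leqNgt leq_eqVlt val_eqE (negbTE ji) /= => /U0 ->.
  by rewrite mul0r.
apply: bndD; first exact: bAv.
apply: bndN; apply: bnd_sum => j ij; apply: bndM; first exact: bA.
apply: IH; rewrite -ltnS; apply: leq_trans hi; apply: ltn_sub2l => //.
Qed.

End Backsubstitution.

(** * Calculus on the life time of a solution *)

Section TimeDomain.
Context {R : realType}.
Implicit Types (t b : R) (T : \bar R).
Local Notation mu := (@lebesgue_measure R).

Lemma dom_itv t0 T b : (b%:E < T)%E -> `[t0, b] `<=` time_dom t0 T.
Proof.
move=> bT t; rewrite /= in_itv /= => /andP[t0t tb]; split=> //.
by apply: le_lt_trans bT; rewrite lee_fin.
Qed.

Lemma dom_nbhs t0 T t : t0 < t -> (t%:E < T)%E -> nbhs t (time_dom t0 T).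
Proof.
move=> t0t tT; have [c tc cT] : exists2 c : R, t < c & (c%:E <= T)%E.
  case: T tT => [c||//]; first by rewrite lte_fin => tc; exists c.
  by move=> _; exists (t + 1); rewrite ?ltrDl// leey.
near=> s; split.
  by apply: ltW; near: s; exact: lt_nbhsr.
apply: lt_le_trans cT; rewrite lte_fin.
by near: s; exact: lt_nbhsl.
Unshelve. all: by end_near. Qed.

(** At interior times of the life time, the one-sided notion of derivative that
    defines solutions is the usual one. *)
Lemma deriv_within_mder t0 T p q (A : R -> 'M[R]_(p, q)) t L :
  deriv_within (time_dom t0 T) A t L -> t0 < t -> (t%:E < T)%E -> mder A t L.
Proof.
move=> dA t0t tT; apply/mderP.
suff H : (h^-1 *: (A (h *: 1 + t) - A t)) @[h --> 0^'] --> L.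
  by apply: DeriveDef; [apply/cvg_ex; exists L|exact/cvg_lim].
apply/cvgrPdist_le => e e0.
move: dA => /cvgrPdist_le/(_ e e0); rewrite near_withinE => /nbhs_ballP[d /= d0 Hd].
have /nbhs_ballP[d' /= d'0 Hd'] := dom_nbhs t0t tT.
apply/nbhs_ballP; exists (Num.min d d'); first by rewrite /= lt_min d0.
move=> h; rewrite /ball /= sub0r normrN lt_min => /andP[hd hd'] h0.
have E : h *: (1 : R) + t = h + t by rewrite /GRing.scale /= mulr1.
have hE : t - (h + t) = - h by ring.
have := Hd (h + t); rewrite /ball /= hE normrN => /(_ hd).
have -> : h + t - t = h by ring.
rewrite E; apply.
  by apply: contra_neq h0 => ht; apply: (addIr t); rewrite add0r.
by apply: Hd'; rewrite /ball /= hE normrN.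
Qed.

Lemma deriv_within_continuous (V : normedModType R) (D : set R) (f f' : R -> V) :
  (forall t, D t -> deriv_within D f t (f' t)) -> {within D, continuous f}.
Proof.
move=> df; apply/subspace_continuousP => t Dt.
apply/cvgrPdist_le => e e0; rewrite near_withinE.
have := df t Dt => /cvgrPdist_le/(_ 1 ltr01).
rewrite near_withinE => /nbhs_ballP[d /= d0 Hd].
pose B := `|f' t| + 1; have B0 : 0 < B by rewrite ltr_wpDl.
apply/nbhs_ballP; exists (Num.min d (e / B)); first by rewrite /= lt_min d0 divr_gt0.
move=> s; rewrite /ball /= lt_min => /andP[sd se] Ds.
have [->|st] := eqVneq s t; first by rewrite subrr normr0 ltW.
have := Hd s sd st Ds => h.
have st0 : s - t != 0 by rewrite subr_eq0.
have -> : f t - f s = - ((s - t) *: ((s - t)^-1 *: (f s - f t))).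
  by rewrite scalerA mulfV// scale1r opprB.
rewrite normrN normrZ.
have qB : `|(s - t)^-1 *: (f s - f t)| <= B.
  rewrite -[X in `|X|](subKr (f' t)); apply: le_trans (ler_normB _ _) _.
  by rewrite lerD2l.
rewrite (le_trans (ler_pM _ _ (lexx _) qB))// distrC -ler_pdivlMr// ltW//.
Qed.

Lemma lip_MVT t0 T (f f' : R -> R) : {within time_dom t0 T, continuous f} ->
  (forall t, t0 < t -> (t%:E < T)%E -> is_derive t (1 : R) f (f' t)) ->
  bnd (time_dom t0 T) f' -> lip (time_dom t0 T) f.
Proof.
move=> cf df /bnd_ge0[B [B0 HB]]; exists B; split=> // s t Ds Dt.
wlog st : s t Ds Dt / s <= t.
  move=> H; have [/H|/ltW/H] := leP s t; first exact.
  by move=> /(_ Dt Ds); rewrite distrC [X in _ * X]distrC.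
have cst : {within `[s, t], continuous f}.
  apply: continuous_subspaceW cf => u; rewrite /= in_itv /= => /andP[su ut].
  split; first by apply: le_trans su; case: Ds.
  by apply: le_lt_trans (proj2 Dt); rewrite lee_fin.
have dst u : u \in `]s, t[ -> is_derive u (1 : R) f (f' u).
  rewrite in_itv /= => /andP[su ut]; apply: df.
    by apply: le_lt_trans su; case: Ds.
  by apply: lt_trans (proj2 Dt); rewrite lte_fin.
have [c /itvP cst' E] := MVT_segment st dst cst.
rewrite distrC E normrM [X in _ <= _ * X]distrC ler_wpM2r//; apply: HB; split.
  by apply: (@le_trans _ _ s); [case: Ds|rewrite cst'].
by apply: le_lt_trans (proj2 Dt); rewrite lee_fin cst'.
Qed.

Lemma deriv_within_lip t0 T p q (A A' : R -> 'M[R]_(p, q)) :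
  (forall t, time_dom t0 T t -> deriv_within (time_dom t0 T) A t (A' t)) ->
  mbnd (time_dom t0 T) A' -> mlip (time_dom t0 T) A.
Proof.
move=> dA bA i j; apply: (lip_MVT (f' := fun t => A' t i j)) => //.
  apply/subspace_continuousP => t Dt.
  have /subspace_continuousP/(_ t Dt) := deriv_within_continuous dA.
  exact: mx_cvg_entry.
move=> t t0t tT.
exact: (deriv_within_mder (dA t (conj (ltW t0t) tT)) t0t tT i j).
Qed.

Lemma mcomp_lip t0 T p q p' q' (X X' : R -> 'M[R]_(p, q))
    (F : 'M[R]_(p, q) -> 'M[R]_(p', q')) : C1 F ->
  mbnd (time_dom t0 T) X -> mbnd (time_dom t0 T) X' -> mlip (time_dom t0 T) X ->
  (forall t, t0 < t -> (t%:E < T)%E -> mder X t (X' t)) ->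
  mlip (time_dom t0 T) (fun t => F (X t)).
Proof.
move=> cF bX bX' lX dX i j.
apply: (lip_MVT (f' := fun t => ('d F (X t) (X' t) : 'M[R]_(p', q')) i j)).
- apply/subspace_continuousP => t Dt.
  have /subspace_continuousP/(_ t Dt) XX := mlip_continuous lX.
  apply: (@mx_cvg_entry _ _ _ _ _ _ (fun s => F (X s)) (F (X t))).
  have cFX : F Y @[Y --> X t] --> F (X t) by have /(_ (X t)) := C1_continuous cF.
  exact: (cvg_comp X F XX cFX).
- move=> t t0t tT; have := mder_comp (dX t t0t tT) (cF.1 (X t)).
  exact.
- exact: diff_bnd.
Qed.

Lemma lip_itv_integrable (f : R -> R) a b : lip `[a, b] f ->
  mu.-integrable `[a, b] (EFin \o f).
Proof.
move=> lf; apply: continuous_compact_integrable; first exact: segment_compact.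
exact: lip_continuous.
Qed.

(** Barbalat's lemma. If f t = e at a late time, the Lipschitz bound keeps f above
    e / 2 during a fixed delay, which costs the integral a fixed amount; but the
    tail of a convergent integral is arbitrarily small. *)
Lemma barbalat t0 (f : R -> R) M : lip `[t0, +oo[ f ->
  (forall t, t0 <= t -> 0 <= f t) ->
  (forall t, t0 <= t -> sint t0 t f <= M) -> f t @[t --> +oo] --> 0.
Proof.
move=> lf f0 fM; have [L [L0 HL]] := lf.
have lab a b : t0 <= a -> lip `[a, b] f.
  move=> ta; apply: lip_sub lf => u; rewrite /= !in_itv /= andbT => /andP[au _].
  exact: le_trans au.
pose E := [set sint t0 t f | t in [set t | t0 <= t]].
have hE : has_sup E.
  split; first by exists (sint t0 t0 f); exists t0 => /=.
  by exists M => _ [t t0t <-]; exact: fM.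
have Esup t : t0 <= t -> sint t0 t f <= sup E.
  by move=> t0t; apply: ub_le_sup; [exact: hE.2|exists t].
apply/cvgrPdist_le => e e0.
pose d := e / (2 * (L + 1)).
have L1 : 0 < L + 1 by rewrite ltr_wpDl.
have d0 : 0 < d by rewrite divr_gt0// mulr_gt0.
have de0 : 0 < d * (e / 2) by rewrite mulr_gt0// divr_gt0.
have [_ [t1 /= t01 <-] Ht1] := sup_adherent de0 hE.
near=> t.
have t1t : t1 <= t by near: t; apply: nbhs_pinfty_ge; exact: num_real.
have t0t : t0 <= t by exact: le_trans t1t.
have td : t <= t + d by rewrite lerDl ltW.
have i1 : sint t0 (t + d) f - sint t0 t f = sint t (t + d) f.
  by apply: sintB => //; exact/lip_itv_integrable/lab.
have i2 : sint t0 t1 f <= sint t0 t f.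
  rewrite -subr_ge0 sintB//; last exact/lip_itv_integrable/lab.
  apply: Rintegral_ge0 => u; rewrite /= in_itv /= => /andP[t1u _].
  by apply: f0; exact: le_trans t1u.
have i3 : (f t - L * d) * d <= sint t (t + d) f.
  have -> : (f t - L * d) * d = sint t (t + d) (fun=> f t - L * d).
    rewrite /sint Rintegral_cst//; congr (_ * _).
    have -> : d = t + d - t by ring.
    have -> : t + (t + d - t) = t + d by ring.
    exact: esym (congr1 fine (mu_itvcc td)).
  apply: le_Rintegral => //.
  - by apply: lip_itv_integrable; exact: lip_cst.
  - exact/lip_itv_integrable/lab.
  move=> u; rewrite /= in_itv /= => /andP[tu ud].
  have := HL t u; rewrite /= !in_itv /= !andbT => /(_ t0t (le_trans t0t tu)).
  move=> /(le_trans (ler_norm _)); rewrite distrC ger0_norm ?subr_ge0//.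
  have : L * (u - t) <= L * d by rewrite ler_wpM2l// lerBlDl.
  lra.
have i4 := Esup (t + d) (le_trans t0t td).
have i5 : (f t - L * d) * d <= d * (e / 2) by lra.
rewrite sub0r normrN ger0_norm ?f0//.
move: i5; rewrite mulrC ler_pM2l// lerBlDr => /le_trans; apply.
have -> : L * d = e / 2 * (L / (L + 1)) by rewrite /d; field; exact: lt0r_neq0.
rewrite [X in _ <= X]splitr lerD2l ler_piMr ?divr_ge0 ?(ltW e0)//.
by rewrite ler_pdivrMr// mul1r lerDl.
Unshelve. all: by end_near. Qed.

End TimeDomain.

Section TimeDomMore.
Context {R : realType}.
Local Notation mu := (@lebesgue_measure R).

Lemma time_domy (t0 : R) : time_dom t0 +oo%E = `[t0, +oo[%classic.
Proof.
apply/seteqP; split=> t /=; rewrite in_itv /= andbT; first by case.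
by move=> t0t; split=> //; exact: ltry.
Qed.

Lemma time_dom_ge0 (t0 : R) T t : time_dom t0 T t -> t0 <= t.
Proof. by case. Qed.

Lemma time_dom_sub (t0 : R) (T T' : \bar R) : (T' <= T)%E -> time_dom t0 T' `<=` time_dom t0 T.
Proof. by move=> TT t [? tT]; split=> //; exact: lt_le_trans TT. Qed.

Lemma measurable_time_dom (t0 : R) T : measurable (time_dom t0 T).
Proof.
case: T => [b||].
- rewrite (_ : time_dom t0 b%:E = `[t0, b[%classic)//.
  apply/seteqP; split=> t; rewrite /= in_itv /=.
    by move=> [-> /=]; rewrite lte_fin.
  by move=> /andP[t0t tb]; split=> //; rewrite lte_fin.
- by rewrite time_domy.
- rewrite (_ : time_dom t0 -oo%E = set0)//.
  by apply/seteqP; split=> t // -[].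
Qed.

Lemma deriv_within_sub (V : normedModType R) (D D' : set R) (f : R -> V) t l :
  D' `<=` D -> deriv_within D f t l -> deriv_within D' f t l.
Proof.
move=> DD H; apply: cvg_trans H; apply: cvg_app => P HP.
by have HP' : \forall s \near t^', D s -> P s := HP; apply: filterS HP' => s Hs /DD.
Qed.

Lemma between (t : R) (T : \bar R) : (t%:E < T)%E -> exists2 b : R, t < b & (b%:E < T)%E.
Proof.
case: T => [c||//].
  rewrite lte_fin => tc; exists ((t + c) / 2); rewrite ?lte_fin; lra.
by move=> _; exists (t + 1); rewrite ?ltrDl// ltry.
Qed.

Lemma mint_derive_ae m (f : R -> 'cV[R]_m) (a b B : R) :
  (forall i, measurable_fun `[a, b] (fun t => f t i 0)) ->
  {ae mu, forall t, `[a, b]%classic t -> forall i, `|f t i 0| <= B} ->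
  {ae mu, forall t, a < t -> t < b -> mder (fun s => vint a s f) t (f t)}.
Proof.
move=> mf bf.
have H i : {ae mu, forall t, a < t -> t < b ->
    is_derive t (1 : R) (fun s => sint a s (fun u => f u i 0)) (f t i 0)}.
  apply: (@sint_derive_ae _ _ a b B) => //.
  by apply: aeS bf => t Ht It; exact: Ht.
have : {ae mu, forall t, forall i, a < t -> t < b ->
    is_derive t (1 : R) (fun s => sint a s (fun u => f u i 0)) (f t i 0)}.
  apply: (@filter_forall _ _ _ _ (ae_filter_ringOfSetsType mu)) => i; exact: H.
apply: aeS => t Ht a_t tb i j; rewrite ord1.
by apply: (is_derive_ext (Ht i a_t tb)) => // s; rewrite mxE.
Qed.

Lemma vint_derive m (f : R -> 'cV[R]_m) a b t : mlip `[a, b] f -> a < t -> t < b ->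
  mder (fun s => vint a s f) t (f t).
Proof.
move=> lf a_t tb i j; rewrite ord1.
apply: (is_derive_ext (sint_derive a_t tb (lip_continuous (lf i 0)))) => // s.
by rewrite mxE.
Qed.

Lemma vint_lip m (f : R -> 'cV[R]_m) a T (B : R) : 0 <= B ->
  (forall i, measurable_fun (time_dom a T) (fun t => f t i 0)) ->
  {ae mu, forall t, time_dom a T t -> forall i, `|f t i 0| <= B} ->
  mlip (time_dom a T) (fun s => vint a s f).
Proof.
move=> B0 mf bf i j; exists B; split=> // s t Ds Dt; rewrite !mxE.
pose b := Num.max s t.
have [_ sT] := Ds; have [_ tT] := Dt.
have bT : (b%:E < T)%E by rewrite /b; case: (leP s t).
have ab : a <= b by rewrite le_max (time_dom_ge0 Ds).
have sub := @dom_itv R a T b bT.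
apply: (sint_lip ab) => //.
- by apply: measurable_funS (mf i) => //; exact: measurable_time_dom.
- by apply: aeS bf => u Hu /sub Du; exact: Hu.
- by rewrite /= in_itv /= (time_dom_ge0 Ds) le_max lexx.
- by rewrite /= in_itv /= (time_dom_ge0 Dt) le_max lexx orbT.
Qed.

Lemma mlip_measurable m (f : R -> 'cV[R]_m) D : measurable D -> mlip D f ->
  forall i, measurable_fun D (fun t => f t i 0).
Proof.
move=> mD lf i; apply: subspace_continuous_measurable_fun => //.
exact: lip_continuous.
Qed.

End TimeDomMore.

Section SintLip.
Context {R : realType}.

Lemma sint_lipD (f g : R -> R) a b : lip `[a, b] f -> lip `[a, b] g ->
  sint a b (fun t => f t + g t) = sint a b f + sint a b g.
Proof. by move=> lf lg; apply: RintegralD => //; exact: lip_itv_integrable. Qed.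

Lemma sint_lipZ (f : R -> R) k a b : lip `[a, b] f ->
  sint a b (fun t => k * f t) = k * sint a b f.
Proof. by move=> lf; apply: RintegralZl => //; exact: lip_itv_integrable. Qed.

Lemma sint_lip_sum (I : Type) (r : seq I) (f : I -> R -> R) a b :
  (forall i, lip `[a, b] (f i)) ->
  sint a b (fun t => \sum_(i <- r) f i t) = \sum_(i <- r) sint a b (f i).
Proof.
move=> lf; elim: r => [|i r IH].
  rewrite big_nil (_ : (fun t => _) = fun=> 0); last by apply/funext => t; rewrite big_nil.
  by rewrite /sint Rintegral_cst// mul0r.
rewrite big_cons -IH -sint_lipD//; last exact: lip_sum.
by congr sint; apply/funext => t; rewrite big_cons.
Qed.

Lemma sint_ge0 (f : R -> R) a b : (forall t, 0 <= f t) -> 0 <= sint a b f.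
Proof. by move=> f0; apply: Rintegral_ge0 => t _. Qed.

End SintLip.

(** * Scalar dissipation inequalities *)

Section Dissipation.
Context {R : realType}.

Lemma young (x y l : R) : 0 < l -> x * y <= l * x ^+ 2 + (4 * l)^-1 * y ^+ 2.
Proof.
move=> l0; rewrite -subr_ge0.
have -> : l * x ^+ 2 + (4 * l)^-1 * y ^+ 2 - x * y = l * (x - (2 * l)^-1 * y) ^+ 2.
  by field; exact: lt0r_neq0.
by rewrite mulr_ge0 ?sqr_ge0// ltW.
Qed.

Lemma ler_normM3 (x X Y A B : R) : `|X| <= A -> `|Y| <= B ->
  - (x * X * Y) <= `|x| * (A * B).
Proof.
move=> hX hY; apply: le_trans (ler_norm _) _.
by rewrite normrN -mulrA !normrM ler_wpM2l// ler_pM.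
Qed.

(** The products e_k e_{k+1} telescope to e_n e_{n+1}, and 3/4 e_n^2 + 1/3 e_{n+1}^2
    dominates the latter. The weight 1/3 < 1/2 leaves a strict gain even when
    a = 1/2; equal weights 1/2 would lose it. *)
Lemma error_chain_dissipation n (e e' : nat -> R) (a r : R) : 2^-1 <= a -> e 0%N = 0 ->
  (forall k, (k < n)%N -> e' k.+1 = e k.+2 - e k.+1 - e k) ->
  e' n.+1 = r - a * e n.+1 ->
  \sum_(k < n.+1) e k.+1 * e' k.+1 <=
    - (6^-1 * \sum_(k < n.+1) e k.+1 ^+ 2) + r * e n.+1.
Proof.
move=> ha e0 eS en; rewrite !big_ord_recr /= en.
pose S := \sum_(k < n) e k.+1 ^+ 2.
have -> : \sum_(k < n) e k.+1 * e' k.+1 = e n * e n.+1 - S.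
  rewrite /S; have -> : e n * e n.+1 = \sum_(k < n) (e k.+1 * e k.+2 - e k * e k.+1).
    rewrite -(big_mkord predT (fun k => e k.+1 * e k.+2 - e k * e k.+1)).
    by rewrite telescope_sumr// e0 mul0r subr0.
  rewrite -sumrB; apply: eq_bigr => k _; rewrite eS//; ring.
have S0 : e n ^+ 2 <= S.
  rewrite /S; case: (n) => [|k]; first by rewrite big_ord0 e0 expr0n.
  by rewrite big_ord_recr /= lerDr sumr_ge0// => i _; exact: sqr_ge0.
have := @young (e n) (e n.+1) (3 / 4); rewrite divr_gt0// => /(_ isT).
have := ler_wpM2r (sqr_ge0 (e n.+1)) ha; rewrite -/S.
have -> : (4 * (3 / 4))^-1 = 3^-1 :> R by field.
have := sqr_ge0 (e n); move: S0; rewrite !expr2; lra.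
Qed.

(** The i-th row of D U D meets only gains K_j with j >= i. Young's inequality
    bounds its off-diagonal part by kd_i r_i^2, with kd_i above a threshold that
    involves the K_j with j > i only, plus a sum of r_j^2 / (2 m) that adds up to
    half of sum r_i^2. Terms with a factor z are absorbed by kp in the same way, at
    the price of z^2 / 12. What is left is r_i (w - c_i s_i) with |w| <= beta_i; its part
    - c_i ed_i s_i, which integrates to |e_{n,i}|, is moved to the left-hand
    side. *)
Lemma regulation_dissipation m (r ed en s Nb Nt d c al K kd zN a beta : 'I_m -> R)
    (U Ub zO rho u : 'I_m -> 'I_m -> R) (rhoN z kp : R) :
  (forall i, r i = ed i + al i * en i) ->
  (forall i, d i ^+ 2 = 1) -> (forall i, U i i = 1) ->
  (forall i j : 'I_m, (j < i)%N -> U i j = 0) ->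
  (forall i, `|Nb i| <= zN i) -> (forall i, `|Nt i| <= rhoN * z) ->
  (forall i j : 'I_m, (i < j)%N -> `|d i * Ub i j * d j| <= zO i j) ->
  (forall i j, `|U i j - Ub i j| <= rho i j * z) ->
  (forall i j, `|U i j| <= u i j) ->
  (forall i, `|s i| <= 1) -> (forall i, s i * en i = `|en i|) ->
  (forall i, 0 < c i) -> (forall i, 0 < al i) -> 0 <= z ->
  (forall i, K i = 1 + kp + kd i) -> (forall i, 0 <= K i) ->
  (forall i, a i = rhoN + \sum_(j < m | (i < j)%N) rho i j * c j) ->
  (forall i, beta i = zN i + \sum_(j < m | (i < j)%N) zO i j * c j) ->
  (forall i, 3 * m%:R * a i ^+ 2 <= kp) ->
  (forall i : 'I_m, m%:R / 2 * \sum_(j < m | (i < j)%N) (u i j * K j) ^+ 2 <= kd i) ->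
  \sum_i (r i * (Nb i + Nt i - d i * \sum_j U i j * (d j * (K j * r j + c j * s j)))
          + c i * (ed i * s i))
  <= 12^-1 * z ^+ 2 - 2^-1 * \sum_i r i ^+ 2
     + \sum_i (beta i * `|ed i| + (beta i - c i) * al i * `|en i|).
Proof.
move=> rE d2 U1 U0 hNb hNt hO hU hu hs hse c0 al0 z0 KE K0 aE bE hkp hkd.
have dn i : `|d i| = 1.
  by apply/eqP; rewrite -(@eqrXn2 _ 2%N)// expr1n real_normK ?num_real// d2.
have [m0|m0] := posnP m.
  have E (F : 'I_m -> R) : \sum_i F i = 0.
    by rewrite big1// => i _; case: i => i im; exfalso; rewrite m0 in im.
  by rewrite !E mulr0 subr0 addr0 mulr_ge0// ?invr_ge0// sqr_ge0.
have mR : 0 < m%:R :> R by rewrite ltr0n.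
pose W (i : 'I_m) := \sum_(j < m | (i < j)%N) d i * U i j * d j * (K j * r j + c j * s j).
have DU i : d i * \sum_j U i j * (d j * (K j * r j + c j * s j)) =
    K i * r i + c i * s i + W i.
  rewrite (bigD1 i)//= U1 mul1r mulrDr mulrA -expr2 d2 mul1r; congr (_ + _).
  rewrite mulr_sumr /W [LHS](bigID (fun j : 'I_m => (i < j)%N)) /= [X in _ + X]big1.
    rewrite addr0; apply: eq_big => [j|j _]; last by rewrite !mulrA.
    by case: ltngtP => //; rewrite ?andbT ?andbF// => ij; rewrite -val_eqE /= ?gtn_eqF.
  move=> j /andP[ji]; rewrite -leqNgt leq_eqVlt val_eqE (negbTE ji) /= => /U0 ->.
  by rewrite mul0r mulr0.
have WB i : - (r i * W i) <= `|r i| * \sum_(j < m | (i < j)%N) zO i j * c j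
    + `|r i| * (\sum_(j < m | (i < j)%N) rho i j * c j) * z
    + \sum_(j < m | (i < j)%N)
        (m%:R / 2 * (u i j * K j) ^+ 2 * r i ^+ 2 + (2 * m%:R)^-1 * r j ^+ 2).
  rewrite /W mulr_sumr -sumrN mulr_sumr mulr_sumr mulr_suml -!big_split /=.
  apply: ler_sum => j ij.
  have -> : - (r i * (d i * U i j * d j * (K j * r j + c j * s j))) =
    - (r i * (d i * Ub i j * d j) * (c j * s j))
    - (r i * (d i * (U i j - Ub i j) * d j) * (c j * s j))
    - r i * (d i * U i j * d j) * (K j * r j) by ring.
  have cs : `|c j * s j| <= c j by rewrite normrM gtr0_norm// ler_piMr ?hs// ltW.
  have dXd X : `|d i * X * d j| = `|X| by rewrite !normrM !dn mul1r mulr1.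
  apply: lerD; first apply: lerD.
  - exact: (ler_normM3 _ (hO i j ij) cs).
  - have -> : `|r i| * (rho i j * c j) * z = `|r i| * ((rho i j * z) * c j) by ring.
    by apply: ler_normM3 cs; rewrite dXd hU.
  have KrB : `|K j * r j| <= K j * `|r j| by rewrite normrM ger0_norm.
  have XB : `|d i * U i j * d j| <= u i j by rewrite dXd.
  apply: le_trans (ler_normM3 _ XB KrB) _.
  have -> : `|r i| * (u i j * (K j * `|r j|)) = (u i j * K j * `|r i|) * `|r j| by ring.
  have m2 : 0 < m%:R / 2 :> R by rewrite divr_gt0.
  apply: le_trans (young _ _ m2) _.
  rewrite exprMn !real_normK ?num_real// mulrA lerD2l.
  by rewrite (_ : 4 * (m%:R / 2) = 2 * m%:R)//; field.
have aB i : `|r i| * a i * z <= 3 * m%:R * a i ^+ 2 * r i ^+ 2 + (12 * m%:R)^-1 * z ^+ 2.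
  have m3 : 0 < 3 * m%:R :> R by rewrite mulr_gt0.
  apply: le_trans (young _ _ m3) _.
  have -> : 4 * (3 * m%:R) = 12 * m%:R :> R by ring.
  by rewrite lerD2r exprMn real_normK ?num_real// mulrCA mulrC.
pose Q (i : 'I_m) := \sum_(j < m | (i < j)%N) (2 * m%:R)^-1 * r j ^+ 2.
have step i : r i * (Nb i + Nt i - d i * \sum_j U i j * (d j * (K j * r j + c j * s j)))
          + c i * (ed i * s i) <=
    (12 * m%:R)^-1 * z ^+ 2 - r i ^+ 2 + Q i
    + (beta i * `|ed i| + (beta i - c i) * al i * `|en i|).
  rewrite DU.
  have -> : r i * (Nb i + Nt i - (K i * r i + c i * s i + W i)) + c i * (ed i * s i) =
     r i * Nb i + r i * Nt i - K i * r i ^+ 2 - c i * (r i - ed i) * s i - r i * W i by ring.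
  have -> : c i * (r i - ed i) * s i = c i * al i * `|en i|.
    by rewrite rE -hse; ring.
  have h1 : r i * Nb i <= `|r i| * zN i.
    by apply: le_trans (ler_norm _) _; rewrite normrM ler_wpM2l.
  have h2 : r i * Nt i <= `|r i| * (rhoN * z).
    by apply: le_trans (ler_norm _) _; rewrite normrM ler_wpM2l.
  have h3 := WB i; have h4 := aB i.
  have h5 : `|r i| * beta i <= (`|ed i| + al i * `|en i|) * beta i.
    apply: ler_wpM2r.
      rewrite bE addr_ge0//; first exact: le_trans (hNb i).
      apply: sumr_ge0 => j ij; apply: mulr_ge0; last exact: ltW.
      exact: le_trans (hO i j ij).
    by rewrite rE (le_trans (ler_normD _ _))// normrM (gtr0_norm (al0 i)).
  have h6 : 3 * m%:R * a i ^+ 2 * r i ^+ 2 <= kp * r i ^+ 2.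
    by rewrite ler_wpM2r ?sqr_ge0.
  have h7 := ler_wpM2r (sqr_ge0 (r i)) (hkd i).
  have h8 : \sum_(j < m | (i < j)%N)
      (m%:R / 2 * (u i j * K j) ^+ 2 * r i ^+ 2 + (2 * m%:R)^-1 * r j ^+ 2) =
      m%:R / 2 * (\sum_(j < m | (i < j)%N) (u i j * K j) ^+ 2) * r i ^+ 2 + Q i.
    by rewrite big_split /= mulr_sumr mulr_suml.
  move: h3 h4; rewrite h8 aE; move: h1 h2 h5 h6 h7; rewrite KE bE.
  set s1 := \sum_(j < m | (i < j)%N) zO i j * c j.
  set s2 := \sum_(j < m | (i < j)%N) rho i j * c j.
  set s3 := \sum_(j < m | (i < j)%N) (u i j * K j) ^+ 2.
  rewrite aE -/s2.
  lra.
apply: le_trans (ler_sum _ (fun i _ => step i)) _.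
rewrite [leLHS]big_split /= lerD2r [leLHS]big_split /= big_split /= sumrN.
rewrite sumr_const card_ord.
have -> : (12 * m%:R)^-1 * z ^+ 2 *+ m = 12^-1 * z ^+ 2.
  by rewrite -[LHS]mulr_natl; field; exact: lt0r_neq0.
rewrite -addrA lerD2l.
suff : \sum_i Q i <= 2^-1 * \sum_i r i ^+ 2 by lra.
rewrite /Q (exchange_big_dep predT) //= mulr_sumr; apply: ler_sum => j _.
rewrite sumr_const -[leLHS]mulr_natl mulrA ler_wpM2r ?sqr_ge0//.
have : (#|fun i : 'I_m => (i < j)%N| <= m)%N by rewrite -[X in (_ <= X)%N]card_ord max_card.
rewrite -(ler_nat R) => /(ler_wpM2r (_ : 0 <= (2 * m%:R)^-1)) h.
apply: le_trans (h _) _; first by rewrite invr_ge0 mulr_ge0// ltW.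
by rewrite invfM mulrCA mulfV ?mulr1 ?lt0r_neq0.
Qed.

End Dissipation.

(** * Euclidean norm, definite matrices and Filippov signs *)

Section MatrixFacts.
Context {R : realType}.

Lemma enorm_ge0 m n (A : 'M[R]_(m, n)) : 0 <= enorm A.
Proof. exact: sqrtr_ge0. Qed.

Lemma enorm_sqr m n (A : 'M[R]_(m, n)) : enorm A ^+ 2 = \sum_i \sum_j A i j ^+ 2.
Proof.
by rewrite sqr_sqrtr// sumr_ge0// => i _; rewrite sumr_ge0// => j _; rewrite sqr_ge0.
Qed.

Lemma entry_le_enorm m n (A : 'M[R]_(m, n)) i j : `|A i j| <= enorm A.
Proof.
rewrite -(@ler_pXn2r _ 2%N)// ?nnegrE ?enorm_ge0// real_normK ?num_real// enorm_sqr.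
rewrite (bigD1 i)//= (bigD1 j)//= -addrA lerDl addr_ge0 ?sumr_ge0// => k _.
  exact: sqr_ge0.
by apply: sumr_ge0 => l _; exact: sqr_ge0.
Qed.

Lemma enorm_bound m n (B : R) : exists C, forall A : 'M[R]_(m, n),
  (forall i j, `|A i j| <= B) -> enorm A <= C.
Proof.
exists (Num.sqrt (\sum_(i < m) \sum_(j < n) B ^+ 2)) => A HA.
rewrite ler_sqrt; last by rewrite sumr_ge0// => i _; rewrite sumr_ge0// => j _; rewrite sqr_ge0.
apply: ler_sum => i _; apply: ler_sum => j _.
rewrite -[X in X <= _]real_normK ?num_real// ler_pXn2r ?nnegrE//.
exact: le_trans (HA i j).
Qed.

Lemma qformE m (A : 'M[R]_m) v : qform A v = \sum_i v i 0 * (A *m v) i 0.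
Proof. by rewrite /qform -mulmxA mxE; apply: eq_bigr => i _; rewrite mxE. Qed.

Lemma posdef_diag m (a : 'rV[R]_m) : sym_posdef (diag_mx a) -> forall i, 0 < a 0 i.
Proof.
move=> [_ H] i; have := H (delta_mx i 0).
have -> : qform (diag_mx a) (delta_mx i 0 : 'cV_m) = a 0 i.
  rewrite qformE (bigD1 i)//= big1 ?addr0.
    by rewrite mul_diag_mx !mxE !eqxx !mulr1 mul1r.
  by move=> j ji; rewrite mxE (negbTE ji) mul0r.
apply; apply/eqP => /matrixP/(_ i 0); rewrite !mxE !eqxx /=.
by apply/eqP; rewrite oner_eq0.
Qed.

Lemma posdef_unit m (A : 'M[R]_m) : sym_posdef A -> A \in unitmx.
Proof.
move=> [_ H]; rewrite -row_free_unit; apply/inj_row_free => v vA.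
apply/eqP; apply: contraT => v0; have := H v^T; rewrite /qform trmxK vA mul0mx mxE ltxx.
by rewrite trmx_eq0; apply.
Qed.

Lemma lambda_min_le m (a : 'rV[R]_m) l : is_lambda_min (diag_mx a) l ->
  forall i, l <= a 0 i.
Proof.
move=> [_ H] i; apply: H; apply/eigenvalueP; exists (delta_mx 0 i).
  apply/rowP => j; rewrite mul_mx_diag !mxE eqxx /=.
  by case: eqP => [->|]; rewrite ?mulr1 ?mul1r// mulr0 mul0r.
apply/eqP => /matrixP/(_ 0 i); rewrite !mxE !eqxx /=.
by apply/eqP; rewrite oner_eq0.
Qed.

End MatrixFacts.

Section SgnValues.
Context {R : realType} {m : nat}.
Implicit Types v s : 'cV[R]_m.

Lemma Sgn_value_le1 v s : Sgn_value v s -> forall i, `|s i 0| <= 1.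
Proof.
move=> Hs i; have [H1 H2] := Hs i.
have [/H2//|/H1->] := eqVneq (v i 0) 0.
by rewrite normr_sg; case: (_ == 0); rewrite ?ler01.
Qed.

Lemma Sgn_value_mul v s : Sgn_value v s -> forall i, s i 0 * v i 0 = `|v i 0|.
Proof.
move=> Hs i; have [H1 _] := Hs i.
have [->|/H1->] := eqVneq (v i 0) 0; first by rewrite mulr0 normr0.
by rewrite normrEsg.
Qed.

(** The values of [Sgn] are subgradients of the absolute value. *)
Lemma abs_subgradient (a b v : R) : `|v| <= 1 -> v * a = `|a| ->
  `|a| - `|b| <= v * (a - b).
Proof.
move=> v1 va; rewrite mulrBr va lerD2l lerN2.
apply: le_trans (ler_norm _) _; rewrite normrM -[leRHS]mul1r; exact: ler_wpM2r.
Qed.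

End SgnValues.

(** * Jets of the tracking error *)

Section Jets.
Context {R : realType} {m : nat}.
Implicit Types e : nat -> 'cV[R]_m.

Lemma err_rec i e :
  err i.+1 (jshift e) = err i.+2 e - err i.+1 e - err i e.
Proof.
rewrite -[err i.+2 e]/(err i.+1 (jshift e) + err i.+1 e + err i e).
by rewrite addrAC addrK addrK.
Qed.

Lemma err_top i e : err i.+1 e = \sum_(j < i) (acoef i.+1 j)%:R *: e j + e i.
Proof.
rewrite errE big_ord_recr; congr (_ + _).
by transitivity ((acoef i.+1 i)%:R *: e i); rewrite // acoef_diag scale1r.
Qed.

Lemma eq_err i e e' : (forall j, (j < i)%N -> e j = e' j) -> err i e = err i e'.
Proof. by move=> ee; rewrite !errE; apply: eq_bigr => j _; rewrite ee. Qed.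

Lemma zvec_sqr (al : 'rV[R]_m) n e : enorm (zvec al n e) ^+ 2 =
  \sum_i (\sum_(k < n) err k.+1 e i 0 ^+ 2 + filtered al n e i 0 ^+ 2).
Proof.
rewrite enorm_sqr; apply: eq_bigr => i _; rewrite big_ord_recr /= mxE ltnn.
by congr (_ + _); apply: eq_bigr => k _; rewrite mxE /= ltn_ord.
Qed.

Lemma zvec_err (al : 'rV[R]_m) n e k i : (k < n)%N ->
  `|err k.+1 e i 0| <= enorm (zvec al n e).
Proof.
move=> kn; have := entry_le_enorm (zvec al n e) i (Ordinal (ltnW kn : (k < n.+1)%N)).
by rewrite mxE /= kn.
Qed.

Lemma zvec_filtered (al : 'rV[R]_m) n e i :
  `|filtered al n e i 0| <= enorm (zvec al n e).
Proof. by have := entry_le_enorm (zvec al n e) i ord_max; rewrite mxE /= ltnn. Qed.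

(** e_{j+1} is e_1^(j) plus a combination of lower derivatives, and r is e_1^(n)
    plus such a combination, so this triangular system can be solved for the jet
    of e_1. It is how bounds and limits for z reach all derivatives of e_1. *)
Lemma jet_le_zvec (al : 'rV[R]_m) n : (0 < n)%N -> exists C, 0 <= C /\
  forall e j i, (j <= n)%N -> `|e j i 0| <= C * enorm (zvec al n e).
Proof.
move=> n0.
have lin (k : nat) (b : nat -> R) (f : nat -> nat) :
  (forall j, (j < k)%N -> exists C, 0 <= C /\ forall e i, `|e (f j) i 0| <= C * enorm (zvec al n e)) ->
  exists C, 0 <= C /\ forall e i, `|(\sum_(j < k) b j *: e (f j)) i 0| <= C * enorm (zvec al n e).
  elim: k => [|k IH] H.
    by exists 0; split=> // e i; rewrite big_ord0 mxE normr0 mul0r.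
  have [|C [C0 HC]] := IH; first by move=> j jk; apply: H; exact: ltnW.
  have [C' [C'0 HC']] := H k (leqnn _).
  exists (C + `|b k| * C'); split; first by rewrite addr_ge0// mulr_ge0.
  move=> e i; rewrite big_ord_recr /= mxE (le_trans (ler_normD _ _))// mulrDl lerD//.
  by rewrite mxE normrM -mulrA ler_wpM2l.
suff H j : (j <= n)%N -> exists C, 0 <= C /\ forall e i, `|e j i 0| <= C * enorm (zvec al n e).
  have [C HC] := choice (fun j : 'I_n.+1 => H j (leq_ord j)).
  exists (\sum_j C j); split; first by apply: sumr_ge0 => j _; exact: (HC j).1.
  move=> e j i jn; have [C0 Hj] := HC (Ordinal (jn : (j < n.+1)%N)).
  apply: le_trans (Hj e i) _; rewrite ler_wpM2r ?enorm_ge0//.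
  by rewrite (bigD1 (Ordinal (jn : (j < n.+1)%N)))//= lerDl sumr_ge0// => k _; exact: (HC k).1.
elim/ltn_ind: j => j IH; rewrite leq_eqVlt => /predU1P[jn|jn].
  case: n n0 lin IH jn => // n _ lin IH jn.
  have [|C [C0 HC]] := lin n (fun j => (acoef n.+1 j)%:R) succn.
    by move=> k kn; apply: IH; rewrite ?jn// ltnS ltnW.
  have E e i : e j i 0 = filtered al n.+1 e i 0 - al 0 i * err n.+1 e i 0
      - (\sum_(k < n) (acoef n.+1 k)%:R *: e k.+1) i 0.
    rewrite /filtered err_top jn /jshift; move: (\sum_(k < n) _) => S.
    by rewrite mul_diag_mx !mxE; ring.
  exists (1 + enorm al + C); split; first by rewrite !addr_ge0// enorm_ge0.
  move=> e i; rewrite E (le_trans (ler_normB _ _))// mulrDl lerD//.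
  rewrite (le_trans (ler_normB _ _))// mulrDl mul1r lerD ?zvec_filtered//.
  by rewrite normrM; apply: ler_pM => //; [exact: entry_le_enorm|exact: zvec_err].
have [|C [C0 HC]] := lin j (fun k => (acoef j.+1 k)%:R) id.
  by move=> k kj; apply: IH => //; exact: ltnW (ltn_trans kj jn).
exists (1 + C); split; first by rewrite addr_ge0.
move=> e i; have -> : e j i 0 = err j.+1 e i 0 - (\sum_(k < j) (acoef j.+1 k)%:R *: e k) i 0.
  by rewrite err_top; move: (\sum_(k < j) _) => Q; rewrite mxE; ring.
by rewrite (le_trans (ler_normB _ _))// mulrDl mul1r lerD// zvec_err.
Qed.

End Jets.

Section ErrCurves.
Context {R : realType} {m : nat}.
Implicit Types (E : nat -> R -> 'cV[R]_m) (D : set R).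

Lemma mder_err i E (E' : nat -> 'cV[R]_m) t : (forall j, (j < i)%N -> mder (E j) t (E' j)) ->
  mder (fun s => err i (E ^~ s)) t (err i E').
Proof.
move=> H; rewrite errE.
have -> : (fun s => err i (E ^~ s)) = (fun s => \sum_(j < i) (acoef i j)%:R *: E j s).
  by apply/funext => s; rewrite errE.
by apply: mder_sum => j _; apply: mderZ; exact: H.
Qed.

Lemma mbnd_err D i E : (forall j, (j < i)%N -> mbnd D (E j)) ->
  mbnd D (fun s => err i (E ^~ s)).
Proof.
move=> H; have -> : (fun s => err i (E ^~ s)) = (fun s => \sum_(j < i) (acoef i j)%:R *: E j s).
  by apply/funext => s; rewrite errE.
by apply: mbnd_sum => j _; apply: mbndZ; exact: H.
Qed.

Lemma mlip_err D i E : (forall j, (j < i)%N -> mlip D (E j)) ->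
  mlip D (fun s => err i (E ^~ s)).
Proof.
move=> H; have -> : (fun s => err i (E ^~ s)) = (fun s => \sum_(j < i) (acoef i j)%:R *: E j s).
  by apply/funext => s; rewrite errE.
by apply: mlip_sum => j _; apply: mlipZ; exact: H.
Qed.

Lemma mbnd_filtered D (al : 'rV[R]_m) n E : (forall j, (j <= n)%N -> mbnd D (E j)) ->
  mbnd D (fun s => filtered al n (E ^~ s)).
Proof.
move=> H; apply: mbndD; first by apply: (@mbnd_err D n (fun j => E j.+1)) => j jn; exact: H.
apply: mbndM; first exact: mbnd_cst.
by apply: mbnd_err => j jn; apply: H; exact: ltnW.
Qed.

Lemma mlip_filtered D (al : 'rV[R]_m) n E : (forall j, (j <= n)%N -> mbnd D (E j)) ->
  (forall j, (j <= n)%N -> mlip D (E j)) ->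
  mlip D (fun s => filtered al n (E ^~ s)).
Proof.
move=> Hb H; apply: mlipD; first by apply: (@mlip_err D n (fun j => E j.+1)) => j jn; exact: H.
apply: mlipM; [exact: mbnd_cst| |exact: mlip_cst|].
  by apply: mbnd_err => j jn; apply: Hb; exact: ltnW.
by apply: mlip_err => j jn; apply: H; exact: ltnW.
Qed.

Lemma mder_state n (x : nat -> R -> 'cV[R]_m) t p' :
  (forall j, (j < n)%N -> mder (x j) t (p' j)) ->
  mder (fun s => state n (x ^~ s)) t (state n p').
Proof.
move=> H i j; apply: (is_derive_ext (H j (ltn_ord j) i 0)) => [s|]; by rewrite mxE.
Qed.

Lemma mbnd_state D n (x : nat -> R -> 'cV[R]_m) :
  (forall j, (j < n)%N -> mbnd D (x j)) -> mbnd D (fun s => state n (x ^~ s)).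
Proof.
by move=> H i j; apply: eq_bnd (H j (ltn_ord j) i 0) => t _; rewrite mxE.
Qed.

Lemma mlip_state D n (x : nat -> R -> 'cV[R]_m) :
  (forall j, (j < n)%N -> mlip D (x j)) -> mlip D (fun s => state n (x ^~ s)).
Proof.
by move=> H i j; apply: eq_lip (H j (ltn_ord j) i 0) => t _; rewrite mxE.
Qed.

Lemma mbnd_enorm D p q (A : R -> 'M[R]_(p, q)) :
  (exists B, forall t, D t -> enorm (A t) <= B) -> mbnd D A.
Proof.
move=> [B HB] i j; exists B => t Dt; exact: le_trans (entry_le_enorm _ _ _) (HB t Dt).
Qed.

Lemma enorm_mbnd D p q (A : R -> 'M[R]_(p, q)) : mbnd D A ->
  exists B, forall t, D t -> enorm (A t) <= B.
Proof.
move=> H; have [B HB] := choice (fun ij : 'I_p * 'I_q => H ij.1 ij.2).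
have [C HC] := @enorm_bound R p q (\sum_ij `|B ij|).
exists C => t Dt; apply: HC => i j; apply: le_trans (HB (i, j) t Dt) _.
apply: le_trans (ler_norm _) _.
by rewrite (bigD1 (i, j))//= lerDl sumr_ge0.
Qed.

End ErrCurves.

(** * Open-loop error equation *)

Section OpenLoop.
Context {R : realType} {m n : nat}.
Variables (h : 'M[R]_(m, n) -> 'cV[R]_m) (g S U : 'M[R]_(m, n) -> 'M[R]_m).
Variables (d al : 'rV[R]_m) (xr : nat -> R -> 'cV[R]_m).
Hypothesis g_SDU : SDU_decomposition g S U d.

Lemma Mmat_sym X : (Mmat S X)^T = Mmat S X.
Proof.
have [_ /(_ X)[SX _] _ _] := g_SDU.
by rewrite /Mmat trmx_inv SX.
Qed.

Lemma Mmat_g X : Mmat S X *m g X = diag_mx d *m U X.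
Proof.
have [_ pS _ gE] := g_SDU; rewrite gE !mulmxA /Mmat mulVmx ?mul1mx//.
exact: posdef_unit.
Qed.

Lemma g_unit X : leading_minors_neq0 (g X) -> g X \in unitmx.
Proof.
move=> /(_ m (leqnn m)); rewrite /leading_minor.
have -> : mxsub (widen_ord (leqnn m)) (widen_ord (leqnn m)) (g X) = g X.
  apply/matrixP => i j; rewrite mxE; congr (g X _ _); exact: val_inj.
by rewrite unitmxE unitfE.
Qed.

(** The time derivative of r when [xn1] is the one of x^(n). *)
Definition filtered_rate (xn1 : 'cV[R]_m) (p : nat -> 'cV[R]_m) (t : R) : 'cV[R]_m :=
  (xr n.+1 t - xn1) + \sum_(j < n.-1) (acoef n j)%:R *: ejet xr p t j.+2
  + diag_mx al *m err n (jshift (ejet xr p t)).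

(** M r' = N - e_n - 1/2 M' r - D U tau': the plant is inverted through
    M g = D U, and g^-1 (x^(n) - h) is tau along a trajectory. *)
Lemma open_loop (g_minors : forall X, leading_minors_neq0 (g X)) (p : nat -> 'cV[R]_m) t tau taud :
  p n = h (state n p) + g (state n p) *m tau ->
  Mmat S (state n p) *m
    filtered_rate (hdot h p + gdot g p *m tau + g (state n p) *m taud) p t
  = Nfun h g S al xr p t - err n (ejet xr p t)
    - 2^-1 *: (Mdot S p *m filtered al n (ejet xr p t))
    - diag_mx d *m U (state n p) *m taud.
Proof.
move=> pn; have MgE : diag_mx d *m U (state n p) *m taud =
    Mmat S (state n p) *m (g (state n p) *m taud) by rewrite -Mmat_g mulmxA.
have tauE : invmx (g (state n p)) *m (p n - h (state n p)) = tau.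
  by rewrite pn (addrC (h _)) addrK mulmxA mulVmx ?g_unit// mul1mx.
have phiE : phifun h g p = hdot h p + gdot g p *m tau.
  by rewrite /phifun -mulmxA tauE.
have alg (M : 'M[R]_m) (a u v w A B x y : 'cV[R]_m) :
    M *m ((a - (u + v + w)) + A + B) =
    (M *m (a + A + B) - M *m (u + v) + x + y) - x - y - M *m w.
  rewrite !mulmxDr mulmxN !mulmxDr.
  move: (M *m u) (M *m v) (M *m w) (M *m A) (M *m B) (M *m a) => Mu Mv Mw MA MB Ma.
  by apply/matrixP => i j; rewrite !mxE; ring.
by rewrite MgE /Nfun /ffun phiE; exact: alg.
Qed.

End OpenLoop.

(** * Reference and closed-loop signals *)

Section Reference.
Context {R : realType} {m n : nat}.
Variables (xr : nat -> R -> 'cV[R]_m) (t0 : R).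
Hypothesis xr_ref : reference (n := n) xr t0.
Local Notation mu := (@lebesgue_measure R).

Lemma ref_bnd j : (j <= n)%N -> mbnd `[t0, +oo[ (xr j).
Proof.
have [_ _ Hb _ _] := xr_ref => /Hb[B HB]; apply: mbnd_enorm; exists B => t.
by rewrite /= in_itv /= andbT; exact: HB.
Qed.

Lemma ref_ae_bnd : exists B, 0 <= B /\
  {ae mu, forall t, t0 <= t -> forall i, `|xr n.+1 t i 0| <= B}.
Proof.
have [_ _ _ [_ [B HB]] _] := xr_ref; exists `|B|; split=> //.
apply: aeS HB => t H t0t i; apply: le_trans (entry_le_enorm _ _ _) _.
exact: le_trans (H t0t) (ler_norm _).
Qed.

Lemma ref_lip j : (j <= n)%N -> mlip `[t0, +oo[ (xr j).
Proof.
have [Hd _ _ [Hm _] Hi] := xr_ref.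
rewrite leq_eqVlt => /predU1P[->|jn]; last first.
  rewrite -time_domy; apply: (@deriv_within_lip _ _ _ _ _ _ (xr j.+1)); rewrite time_domy.
    by move=> t; rewrite /= in_itv /= andbT; exact: Hd.
  exact: ref_bnd.
have [B [B0 HB]] := ref_ae_bnd.
apply: (@eq_mlip _ _ _ _ (fun t => xr n t0 + vint t0 t (xr n.+1))).
  by move=> t; rewrite /= in_itv /= andbT => t0t; rewrite [RHS]Hi.
apply: mlipD; first exact: mlip_cst.
rewrite -time_domy; apply: (vint_lip B0); rewrite time_domy//.
by apply: aeS HB => t H; rewrite /= in_itv /= andbT; exact: H.
Qed.

Lemma ref_deriv j t : (j < n)%N -> t0 < t -> mder (xr j) t (xr j.+1 t).
Proof.
have [Hd _ _ _ _] := xr_ref => jn t0t.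
apply: (@deriv_within_mder _ t0 +oo%E); rewrite ?ltry// time_domy.
exact: Hd jn _ (ltW t0t).
Qed.

Lemma ref_deriv_ae b :
  {ae mu, forall t, t0 < t -> t < b -> mder (xr n) t (xr n.+1 t)}.
Proof.
have [_ _ _ [Hm _] Hi] := xr_ref; have [B [B0 HB]] := ref_ae_bnd.
have : {ae mu, forall t, t0 < t -> t < b -> mder (fun s => vint t0 s (xr n.+1)) t (xr n.+1 t)}.
  apply: (@mint_derive_ae _ _ _ t0 b B).
    move=> i; apply: measurable_funS (Hm i) => //; apply: subset_itvl; exact: ltW.
  by apply: aeS HB => t H; rewrite /= in_itv /= => /andP[/H].
apply: aeS => t H t0t tb.
have := mderD (mder_cst (xr n t0) t) (H t0t tb); rewrite add0r.
apply: mder_near; near=> s; rewrite -Hi//.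
by apply: ltW; near: s; exact: lt_nbhsr.
Unshelve. all: by end_near. Qed.

End Reference.

Section ClosedLoopSignals.
Context {R : realType} {m n : nat}.
Variables (h : 'M[R]_(m, n) -> 'cV[R]_m) (g : 'M[R]_(m, n) -> 'M[R]_m).
Variables (d al c : 'rV[R]_m) (K : 'M[R]_m) (xr : nat -> R -> 'cV[R]_m) (t0 : R).
Variables (T : \bar R) (x : nat -> R -> 'cV[R]_m) (s : R -> 'cV[R]_m) (X0 : 'M[R]_(m, n)).
Hypotheses (h_C1 : C1 h) (g_C1 : C1 g).
Hypothesis xr_ref : reference (n := n) xr t0.
Hypothesis sol : closed_loop_solution h g d al xr c K t0 x s T X0.
Local Notation mu := (@lebesgue_measure R).

Let E j t : 'cV[R]_m := xr j t - x j t.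
Let X t := state n (x ^~ t).
Let tau := control (n := n) d al xr c K t0 x s.

Lemma x_deriv j t : (j < n)%N -> t0 < t -> (t%:E < T)%E -> mder (x j) t (x j.+1 t).
Proof.
have [_ Hd _ _ _] := sol => jn t0t tT.
exact: deriv_within_mder (Hd j jn t (conj (ltW t0t) tT)) t0t tT.
Qed.

Lemma dom_ref T' : time_dom t0 T' `<=` `[t0, +oo[.
Proof. by move=> t [t0t _]; rewrite /= in_itv /= t0t. Qed.

Lemma E_bnd T' j : (j <= n)%N -> mbnd (time_dom t0 T') (x j) -> mbnd (time_dom t0 T') (E j).
Proof.
move=> jn Hx; apply: mbndD; last exact: mbndN.
by apply: mbnd_sub (ref_bnd xr_ref jn); exact: dom_ref.
Qed.

Lemma E_lip T' j : (j <= n)%N -> mlip (time_dom t0 T') (x j) -> mlip (time_dom t0 T') (E j).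
Proof.
move=> jn Hx; apply: mlipD; last exact: mlipN.
by apply: mlip_sub (ref_lip xr_ref jn); exact: dom_ref.
Qed.

Lemma x_lip T' j : (T' <= T)%E -> (j < n)%N -> mbnd (time_dom t0 T') (x j.+1) ->
  mlip (time_dom t0 T') (x j).
Proof.
have [_ Hd _ _ _] := sol => TT jn Hb.
apply: deriv_within_lip Hb => t Dt; apply: (deriv_within_sub (time_dom_sub TT)).
by apply: Hd => //; exact: time_dom_sub Dt.
Qed.

Lemma s_bnd : {ae mu, forall t, time_dom t0 T t -> forall i, `|s t i 0| <= 1}.
Proof.
have [_ _ _ _ Hs] := sol; apply: aeW => t Dt; exact: Sgn_value_le1 (Hs t Dt).
Qed.

Lemma Pi_bnd : exists B, 0 <= B /\
  {ae mu, forall t, time_dom t0 T t -> forall i, `|(diag_mx c *m s t) i 0| <= B}.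
Proof.
exists (enorm c); split; first exact: enorm_ge0.
apply: aeS s_bnd => t H Dt i; rewrite mul_diag_mx mxE normrM.
rewrite -[leRHS]mulr1; apply: ler_pM => //; first exact: entry_le_enorm.
exact: H.
Qed.

Lemma Pi_measurable i : measurable_fun (time_dom t0 T) (fun t => (diag_mx c *m s t) i 0).
Proof.
have [_ _ _ Hm _] := sol.
have -> : (fun t => (diag_mx c *m s t) i 0) = (fun t => c 0 i * s t i 0).
  by apply/funext => t; rewrite mul_diag_mx mxE.
by apply: measurable_funM => //; exact: Hm.
Qed.

Lemma Pi_lip : mlip (time_dom t0 T) (Pi_signal c t0 s).
Proof. by have [B [B0 HB]] := Pi_bnd; apply: (vint_lip B0) => //; exact: Pi_measurable. Qed.

Lemma int_err_lip T' :
  (forall i, measurable_fun (time_dom t0 T') (fun t => err n (E ^~ t) i 0)) ->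
  mbnd (time_dom t0 T') (fun t => err n (E ^~ t)) ->
  mlip (time_dom t0 T') (fun t => vint t0 t (fun u => err n (E ^~ u))).
Proof.
move=> mE bE; have [B HB] := enorm_mbnd bE.
have B0 : 0 <= `|B| by [].
apply: (vint_lip B0) => //.
apply: aeW => t Dt i; apply: le_trans (entry_le_enorm _ _ _) _.
exact: le_trans (HB t Dt) (ler_norm _).
Qed.

Lemma control_lip T' : (T' <= T)%E ->
  mlip (time_dom t0 T') (fun t => err n (E ^~ t)) ->
  mbnd (time_dom t0 T') (fun t => err n (E ^~ t)) ->
  mlip (time_dom t0 T') tau.
Proof.
move=> TT lE bE.
apply: mlipD; last first.
  by apply: (mlipMl (diag_mx d)); apply: mlip_sub Pi_lip; exact: time_dom_sub.
apply: (mlipMl (diag_mx d *m K)).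
have mE : forall i, measurable_fun (time_dom t0 T') (fun t => err n (E ^~ t) i 0).
  by apply: mlip_measurable => //; exact: measurable_time_dom.
apply: mlipD; last exact: (mlipMl (diag_mx al) (int_err_lip mE bE)).
by apply: mlipD => //; apply: mlip_cst.
Qed.

(** x^(n) = h(X) + g(X) tau is not differentiable everywhere, but h and g are C1
    and tau is Lipschitz because Sgn(e_n) is bounded; so Lipschitz bounds follow
    from mere boundedness on any initial part of the life time. *)
Lemma signals_lip T' : (T' <= T)%E -> (forall j, (j <= n)%N -> mbnd (time_dom t0 T') (x j)) ->
  mbnd (time_dom t0 T') tau -> forall j, (j <= n)%N -> mlip (time_dom t0 T') (x j).
Proof.
move=> TT bx bt.
have lx j : (j < n)%N -> mlip (time_dom t0 T') (x j).
  by move=> jn; apply: x_lip => //; exact: bx.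
move=> j; rewrite leq_eqVlt => /predU1P[->|]; last exact: lx.
have [_ _ Hn _ _] := sol.
apply: (@eq_mlip _ _ _ _ (fun t => h (X t) + g (X t) *m tau t)).
  by move=> t Dt; rewrite [RHS]Hn//; exact: time_dom_sub Dt.
have bX : mbnd (time_dom t0 T') X by apply: mbnd_state => k kn; apply: bx; exact: ltnW.
have bX' : mbnd (time_dom t0 T') (fun t => state n (jshift (x ^~ t))).
  by apply: (mbnd_state (x := fun j => x j.+1)) => k kn; exact: bx.
have lX : mlip (time_dom t0 T') X by apply: mlip_state => k kn; exact: lx.
have dX t : t0 < t -> (t%:E < T')%E -> mder X t (state n (jshift (x ^~ t))).
  move=> t0t tT; apply: (@mder_state _ _ _ _ _ (jshift (x ^~ t))) => k kn.
  by apply: x_deriv => //; exact: lt_le_trans TT.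
apply: mlipD; first exact: mcomp_lip bX bX' lX dX.
apply: mlipM => //.
- by apply: mcomp_bnd bX; exact: C1_continuous.
- exact: mcomp_lip bX bX' lX dX.
apply: control_lip => //.
  by apply: mlip_err => k kn; apply: E_lip; [exact: ltnW|exact: lx].
by apply: mbnd_err => k kn; apply: E_bnd; [|apply: bx]; exact: ltnW.
Qed.

(** No bound is known yet at the right end of the life time, but before it the
    state is continuous on a compact interval, and the integrals of bounded
    functions that make up tau are bounded there. *)
Lemma local_bnd b : (b%:E < T)%E ->
  (forall j, (j <= n)%N -> mbnd (time_dom t0 b%:E) (x j)) /\ mbnd (time_dom t0 b%:E) tau.
Proof.
move=> bT; have bT' := ltW bT.
have Dab t : time_dom t0 b%:E t -> t0 <= t <= b.
  by move=> [-> /=]; rewrite lte_fin; exact: ltW.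
have Dsub : time_dom t0 b%:E `<=` `[t0, b] by move=> t /Dab; rewrite /= in_itv.
have sub := dom_itv (t0 := t0) bT.
have [_ Hd Hn _ _] := sol.
have cx j : (j < n)%N -> {within `[t0, b], continuous (x j)}.
  move=> jn; apply: continuous_subspaceW sub _.
  by apply: deriv_within_continuous => t; exact: Hd.
have bx j : (j < n)%N -> mbnd (time_dom t0 b%:E) (x j).
  move=> jn i k; apply: (bnd_sub Dsub).
  have ci : {within `[t0, b], continuous (fun t => x j t i k)}.
    apply/subspace_continuousP => t It.
    by apply: mx_cvg_entry; have /subspace_continuousP := cx j jn; exact.
  have /compact_bounded[M [_ HM]] := continuous_compact ci (@segment_compact R t0 b).
  by exists (M + 1) => t It; apply: (HM (M + 1)); rewrite ?ltrDl//; exists t.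
have bE : mbnd (time_dom t0 b%:E) (fun t => err n (E ^~ t)).
  by apply: mbnd_err => k kn; apply: E_bnd; [exact: ltnW|exact: bx].
have mE i : measurable_fun (time_dom t0 b%:E) (fun t => err n (E ^~ t) i 0).
  have -> : (fun t => err n (E ^~ t) i 0) =
      (fun t => \sum_(j < n) (acoef n j)%:R * (xr j t i 0 - x j t i 0)).
    apply/funext => t; rewrite errE summxE; apply: eq_bigr => j _.
    by rewrite !mxE.
  apply: measurable_sum => j; apply: measurable_funM => //; apply: measurable_funB.
    apply: mlip_measurable; first exact: measurable_time_dom.
    by apply: mlip_sub (ref_lip xr_ref (ltnW (ltn_ord j))); exact: dom_ref.
  apply: subspace_continuous_measurable_fun; first exact: measurable_time_dom.
  apply: continuous_subspaceW Dsub _.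
  apply/subspace_continuousP => t It.
  apply: mx_cvg_entry; have /subspace_continuousP := cx j (ltn_ord j); exact.
have bt : mbnd (time_dom t0 b%:E) tau.
  apply: mbndD; apply: mbndM; try exact: mbnd_cst; last first.
    apply: mlip_bnd_itv Dab; apply: mlip_sub Pi_lip.
    exact: time_dom_sub bT'.
  apply: mbndD.
    by apply: mbndD => //; exact: mbnd_cst.
  apply: mbndM; first exact: mbnd_cst.
  exact: mlip_bnd_itv (int_err_lip mE bE) Dab.
split=> // j; rewrite leq_eqVlt => /predU1P[->|]; last exact: bx.
apply: (@eq_mbnd _ _ _ _ (fun t => h (X t) + g (X t) *m tau t)).
  by move=> t Dt; rewrite [RHS]Hn//; exact: time_dom_sub Dt.
have bX : mbnd (time_dom t0 b%:E) X by apply: mbnd_state => k kn; exact: bx.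
apply: mbndD; first by apply: mcomp_bnd bX; exact: C1_continuous.
by apply: mbndM => //; apply: mcomp_bnd bX; exact: C1_continuous.
Qed.

Lemma x_top_eq t : time_dom t0 T t -> x n t = h (X t) + g (X t) *m tau t.
Proof. by have [_ _ Hn _ _] := sol; exact: Hn. Qed.

Let taud := control_rate (n := n) d al xr c K x s.
Let xn1 t := hdot h (x ^~ t) + gdot g (x ^~ t) *m tau t + g (X t) *m taud t.

Lemma E_deriv j t : (j < n)%N -> t0 < t -> (t%:E < T)%E -> mder (E j) t (E j.+1 t).
Proof.
move=> jn t0t tT; apply: mderB; first exact: (ref_deriv xr_ref jn t0t).
exact: x_deriv.
Qed.

Lemma control_deriv_ae b : (b%:E < T)%E ->
  {ae mu, forall t, t0 < t -> t < b -> mder tau t (taud t)}.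
Proof.
move=> bT; have [B [B0 HB]] := Pi_bnd.
have sub := dom_itv (t0 := t0) bT.
have HPi : {ae mu, forall t, t0 < t -> t < b -> mder (Pi_signal c t0 s) t (diag_mx c *m s t)}.
  apply: (@mint_derive_ae _ _ _ t0 b B).
    by move=> i; apply: measurable_funS (Pi_measurable i) => //; exact: measurable_time_dom.
  by apply: aeS HB => t H It; apply: H; exact: sub.
have [b' bb' bT'] := between bT.
have [bx bt] := local_bnd bT'.
have lx := signals_lip (ltW bT') bx bt.
have sub' : `[t0, b] `<=` time_dom t0 b'%:E by apply: dom_itv; rewrite lte_fin.
have lE : mlip `[t0, b] (fun t => err n (E ^~ t)).
  apply: mlip_sub sub' _; apply: mlip_err => j jn; apply: E_lip; first exact: ltnW.
  exact: lx (ltnW jn).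
apply: aeS HPi => t HPi t0t tb.
have tT : (t%:E < T)%E by apply: lt_trans bT; rewrite lte_fin.
have dE : mder (fun u => err n (E ^~ u)) t (err n (jshift (E ^~ t))).
  by apply: mder_err => j jn; exact: E_deriv.
have dI := vint_derive lE t0t tb.
have dErr := mderB dE (mder_cst (err n (E ^~ t0)) t).
have dfb := mderMl (diag_mx d *m K) (mderD dErr (mderMl (diag_mx al) dI)).
have := mderD dfb (mderMl (diag_mx d) (HPi t0t tb)).
by rewrite subr0 mulmxA.
Qed.

Lemma X_deriv t : t0 < t -> (t%:E < T)%E -> mder X t (state n (jshift (x ^~ t))).
Proof.
by move=> t0t tT; apply: (@mder_state _ _ _ _ _ (jshift (x ^~ t))) => k kn; exact: x_deriv.
Qed.

Lemma x_top_deriv t : t0 < t -> (t%:E < T)%E -> mder tau t (taud t) ->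
  mder (x n) t (xn1 t).
Proof.
move=> t0t tT dtau; have dX := X_deriv t0t tT.
have dh := mder_comp dX (h_C1.1 (X t)).
have dg := mder_comp dX (g_C1.1 (X t)).
have := mderD dh (mderM dg dtau); rewrite addrA.
apply: mder_near; near=> u; rewrite x_top_eq//.
by near: u; exact: dom_nbhs.
Unshelve. all: by end_near. Qed.

(** In e_n', only the top derivative e_1^(n) needs the derivative of x^(n); its
    coefficient is 1. *)
Lemma filtered_deriv t : (0 < n)%N -> t0 < t -> (t%:E < T)%E -> mder tau t (taud t) ->
  mder (xr n) t (xr n.+1 t) ->
  mder (fun u => filtered al n (E ^~ u)) t
    (filtered_rate (n := n) al xr (xn1 t) (x ^~ t) t).
Proof.
move=> n0 t0t tT dtau dxr; have dx := x_top_deriv t0t tT dtau.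
have dE : mder (fun u => err n (E ^~ u)) t (err n (jshift (E ^~ t))).
  by apply: mder_err => j jn; exact: E_deriv.
pose E' j := if j.+1 == n then xr n.+1 t - xn1 t else E j.+2 t.
have dE1 : mder (fun u => err n (fun j => E j.+1 u)) t (err n E').
  apply: (@mder_err _ _ n (fun j => E j.+1)) => j jn; rewrite /E'.
  case: eqP => [->|/eqP jn1]; first exact: mderB.
  by apply: E_deriv => //; rewrite ltn_neqAle jn1.
have -> : filtered_rate (n := n) al xr (xn1 t) (x ^~ t) t =
    err n E' + diag_mx al *m err n (jshift (E ^~ t)).
  rewrite /filtered_rate; congr (_ + _).
  have nE : n = n.-1.+1 by rewrite prednK.
  have -> : err n E' = err n.-1.+1 E' by rewrite -nE.
  rewrite err_top -nE addrC; congr (_ + _); last by rewrite /E' -nE eqxx.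
  apply: eq_bigr => j _; rewrite /E' ifF//.
  by apply/eqP => jn; have := ltn_ord j; rewrite -ltnS -nE jn ltnn.
exact: mderD dE1 (mderMl (diag_mx al) dE).
Qed.

End ClosedLoopSignals.

(** * Energy estimate and its consequences *)

Section Lyapunov.
Context {R : realType} {m n : nat}.
Hypotheses (n_gt0 : (0 < n)%N).
Variables (h : 'M[R]_(m, n) -> 'cV[R]_m) (g S U : 'M[R]_(m, n) -> 'M[R]_m).
Variables (d al c : 'rV[R]_m) (xr : nat -> R -> 'cV[R]_m) (t0 : R).
Hypothesis g_minors : forall X, leading_minors_neq0 (g X).
Hypothesis g_SDU : SDU_decomposition g S U d.
Hypotheses (h_C1 : C1 h) (g_C1 : C1 g) (M_C1 : C1 (Mmat S)).
Hypothesis xr_ref : reference (n := n) xr t0.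
Variables (zN : 'cV[R]_m) (zU zO : 'M[R]_m).
Hypotheses (zN_gt0 : forall i, 0 < zN i 0) (zO_gt0 : forall i j, 0 < zO i j).
Hypotheses (al_ge : forall i, 2^-1 <= al 0 i) (c_gt0 : forall i, 0 < c 0 i).
Variables (rhoN : R -> R) (rhoU : 'I_m -> 'I_m -> R -> R).
Hypotheses (rhoN_fun : bounding_fun rhoN) (rhoU_fun : forall i j, bounding_fun (rhoU i j)).
Local Notation mu := (@lebesgue_measure R).
Hypothesis Ntilde_bound : {ae mu, forall t, t0 <= t ->
    forall p : nat -> 'cV[R]_m,
      enorm (Ntilde h g S al xr p t)
      <= rhoN (enorm (zvec al n (ejet xr p t))) * enorm (zvec al n (ejet xr p t))}.
Hypothesis Utilde_bound : forall t, t0 <= t ->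
    forall (p : nat -> 'cV[R]_m) (i j : 'I_m),
      `|Utilde U xr p t i j|
      <= rhoU i j (enorm (zvec al n (ejet xr p t))) * enorm (zvec al n (ejet xr p t)).
Hypothesis Nbar_bound : {ae mu, forall t, t0 <= t ->
    forall i, `|Nbar h g S al xr t i 0| <= zN i 0}.
Hypothesis Ubar_bound : forall t, t0 <= t -> forall i j, `|Ubar U xr t i j| <= zU i j.
Hypothesis Omega_bound : forall t, t0 <= t ->
    forall i j, `|Omega U d xr t i j| <= zO i j.

(** Bound beta_i on the part of the i-th error equation that does not vanish with
    z: Nbar_i and the coupling of the discontinuous terms through Omega. *)
Definition feedforward_bound (i : 'I_m) := zN i 0 + \sum_(j < m | (i < j)%N) zO i j * c 0 j.
Local Notation beta := feedforward_bound.

Variables (gam1 gam2 : R) (gam2_gt0 : 0 < gam2).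
Hypothesis c_large : forall i, beta i * (1 + gam2 / al 0 i) <= c 0 i.

Definition energy (e : nat -> 'cV[R]_m) (X : 'M[R]_(m, n)) : R :=
  2^-1 * \sum_i \sum_(k < n) err k.+1 e i 0 ^+ 2
  + 2^-1 * qform (Mmat S X) (filtered al n e).

(* Rb is the radius of the ball of z-space that no solution will leave. *)
Variables (Rb kp : R) (kd : seq R).
(** Coefficient of |r_i| |z| in the energy balance inside the ball. *)
Definition residual_gain (i : 'I_m) :=
  rhoN Rb + \sum_(j < m | (i < j)%N) rhoU i j Rb * c 0 j.
Definition coupling_bound (i j : 'I_m) := zU i j + rhoU i j Rb * Rb.
Definition diag_gain (i : 'I_m) := 1 + kp + kd`_i.
Hypothesis diag_gain_ge0 : forall i, 0 <= diag_gain i.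
Hypothesis kp_large : forall i, 3 * m%:R * residual_gain i ^+ 2 <= kp.
Hypothesis kd_large : forall i : 'I_m,
  m%:R / 2 * \sum_(j < m | (i < j)%N) (coupling_bound i j * diag_gain j) ^+ 2 <= kd`_i.
Local Notation K := (gain_matrix m kp kd).

Variables (T : \bar R) (x : nat -> R -> 'cV[R]_m) (s : R -> 'cV[R]_m) (X0 : 'M[R]_(m, n)).
Hypothesis sol : closed_loop_solution h g d al xr c K t0 x s T X0.

Let E j t : 'cV[R]_m := xr j t - x j t.
Let X t := state n (x ^~ t).
Let tau := control (n := n) d al xr c K t0 x s.
Let taud := control_rate (n := n) d al xr c K x s.
Let r t := filtered al n (E ^~ t).
Let zn t := enorm (zvec al n (E ^~ t)).
Let V t := energy (E ^~ t) (X t).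

Lemma gain_matrix_mul (v : 'cV[R]_m) i : (K *m v) i 0 = diag_gain i * v i 0.
Proof.
rewrite /gain_matrix !mulmxDl mul1mx mul_scalar_mx mul_diag_mx !mxE /diag_gain; ring.
Qed.

Lemma control_rateE t i : taud t i 0 =
  d 0 i * (diag_gain i * r t i 0 + c 0 i * s t i 0).
Proof.
rewrite /taud /control_rate mxE -!mulmxA !mul_diag_mx [in LHS]mxE gain_matrix_mul !mxE.
by rewrite -/(r t); ring.
Qed.

(** Upper bound for the derivative of V + sum_i c_i |e_{n,i}|. It is continuous,
    unlike that derivative. *)
Definition dissipation_rate t : R :=
  - (12^-1 * zn t ^+ 2) + \sum_i (beta i * `|err n (jshift (E ^~ t)) i 0|
      + (beta i - c 0 i) * al 0 i * `|err n (E ^~ t) i 0|).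

(** The closed-loop value of dV/dt, with r' eliminated by [open_loop]; the sum
    over j is the i-th entry of U tau'. *)
Definition energy_rate t : R :=
  \sum_i \sum_(k < n) err k.+1 (E ^~ t) i 0 * err k.+1 (jshift (E ^~ t)) i 0
  + \sum_i r t i 0 * (Nfun h g S al xr (x ^~ t) t i 0 - err n (E ^~ t) i 0
      - d 0 i * \sum_j U (X t) i j *
          (d 0 j * (diag_gain j * r t j 0 + c 0 j * s t j 0))).

(** The term 1/2 r^T M' r that comes from the time dependence of M(X) cancels
    against the one that r^T M r' contains by [open_loop]. *)
Lemma energy_deriv t : t0 < t -> (t%:E < T)%E -> mder tau t (taud t) ->
  mder (xr n) t (xr n.+1 t) ->
  is_derive t (1 : R) V (energy_rate t).
Proof.
move=> t0t tT dtau dxr.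
have dr := filtered_deriv h_C1 g_C1 xr_ref sol n_gt0 t0t tT dtau dxr.
set r' := filtered_rate _ _ _ _ _ in dr.
have dM := mder_comp (X_deriv sol t0t tT) (M_C1.1 (X t)).
have dq := mderM (mderM (mder_tr dr) dM) dr 0 0.
have de i k : (k < n)%N -> is_derive t (1 : R) (fun u => err k.+1 (E ^~ u) i 0)
    (err k.+1 (jshift (E ^~ t)) i 0).
  move=> kn; apply: mder_err => j jk; apply: (E_deriv xr_ref sol) => //.
  exact: leq_trans kn.
have d1 := @is_derive_sumf R _ (index_enum 'I_m) predT _ _ t (fun i _ =>
  @is_derive_sumf R _ (index_enum 'I_n) predT _ _ t (fun k _ =>
    is_derive_mul (de i k (ltn_ord k)) (de i k (ltn_ord k)))).
have := is_deriveD (is_derive_mul (is_derive_cst (2^-1 : R) t 1) d1)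
   (is_derive_mul (is_derive_cst (2^-1 : R) t 1) dq).
move=> H; apply: (is_derive_ext H).
  by move=> u; rewrite /V /energy /qform; congr (_ * _ + _); apply: eq_bigr.
rewrite /energy_rate /cst /= !mul0r !add0r; congr (_ + _).
  rewrite mulr_sumr; apply: eq_bigr => i _; rewrite mulr_sumr; apply: eq_bigr => k _.
  by field.
have pn := x_top_eq sol (conj (ltW t0t) tT).
have OL := open_loop al xr g_SDU g_minors t (taud t) pn.
rewrite -/r' in OL.
have sym : (r'^T *m Mmat S (X t) *m r t) 0 0 = ((r t)^T *m Mmat S (X t) *m r') 0 0.
  transitivity ((r'^T *m Mmat S (X t) *m r t)^T 0 0); first by rewrite [RHS]mxE.
  by rewrite !trmx_mul trmxK (Mmat_sym g_SDU) mulmxA.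
pose Mt := Mmat S (X t); pose Md := Mdot S (x ^~ t).
have key : 2^-1 * (((r'^T *m Mt + (r t)^T *m Md) *m r t + (r t)^T *m Mt *m r') 0 0) =
    ((r t)^T *m (Mt *m r' + 2^-1 *: (Md *m r t))) 0 0.
  rewrite mulmxDl mulmxDr -scalemxAr !mulmxA.
  move: sym; rewrite -/Mt.
  move: (r'^T *m _ *m _) (_ *m r') (_ *m Md *m _) => A B C.
  by rewrite !mxE => ->; field.
transitivity (((r t)^T *m (Mt *m r' + 2^-1 *: (Md *m r t))) 0 0); first exact: key.
have -> : Mt *m r' + 2^-1 *: (Md *m r t) = Nfun h g S al xr (x ^~ t) t
    - err n (E ^~ t) - diag_mx d *m U (X t) *m taud t.
  rewrite /Mt [X in X + _]OL; move: (2^-1 *: _) (Nfun _ _ _ _ _ _ _) => A B.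
  by rewrite addrAC subrK.
rewrite mxE; apply: eq_bigr => i _; rewrite [in LHS]mxE; congr (_ * _).
rewrite -mulmxA mul_diag_mx !mxE; congr (_ - _ * _).
by apply: eq_bigr => j _; rewrite control_rateE.
Qed.

Lemma Utilde_ball t i j : time_dom t0 T t -> zn t <= Rb ->
  `|U (X t) i j - Ubar U xr t i j| <= rhoU i j Rb * zn t.
Proof.
move=> Dt zR; have := Utilde_bound (time_dom_ge0 Dt) (x ^~ t) i j.
rewrite /Utilde mxE [X in _ + X]mxE => /le_trans; apply.
by have [_ H _] := rhoU_fun i j; apply: ler_wpM2r; [|apply: H]; rewrite ?enorm_ge0.
Qed.

Lemma U_ball t i j : time_dom t0 T t -> zn t <= Rb ->
  `|U (X t) i j| <= coupling_bound i j.
Proof.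
move=> Dt zR; rewrite -[U (X t) i j](subrKC (Ubar U xr t i j)).
apply: le_trans (ler_normD _ _) _.
apply: lerD; first exact: Ubar_bound (time_dom_ge0 Dt) _ _.
apply: le_trans (Utilde_ball _ _ Dt zR) _; apply: ler_wpM2l => //.
have [H _ _] := rhoU_fun i j; apply: H.
exact: le_trans (enorm_ge0 _) zR.
Qed.

Lemma dissipation_pointwise t : time_dom t0 T t -> zn t <= Rb ->
  (forall i, `|Nbar h g S al xr t i 0| <= zN i 0) ->
  enorm (Ntilde h g S al xr (x ^~ t) t) <= rhoN (zn t) * zn t ->
  energy_rate t + \sum_i c 0 i * (err n (jshift (E ^~ t)) i 0 * s t i 0)
  <= dissipation_rate t.
Proof.
move=> Dt zR hNb hNt; have t0t := time_dom_ge0 Dt.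
have z0 : 0 <= zn t by exact: enorm_ge0.
have Rb0 : 0 <= Rb by exact: le_trans zR.
have [d1 SP Uut gE] := g_SDU.
have al_gt0 i : 0 < al 0 i by apply: lt_le_trans (al_ge i); rewrite invr_gt0.
have rE i : r t i 0 = err n (jshift (E ^~ t)) i 0 + al 0 i * err n (E ^~ t) i 0.
  by rewrite /r /filtered mxE mul_diag_mx [X in _ + X]mxE.
have [_ _ _ _ Hs] := sol.
have hs := Sgn_value_le1 (Hs t Dt).
have hse := Sgn_value_mul (Hs t Dt).
have chain i : \sum_(k < n) err k.+1 (E ^~ t) i 0 * err k.+1 (jshift (E ^~ t)) i 0 <=
    - (6^-1 * \sum_(k < n) err k.+1 (E ^~ t) i 0 ^+ 2) + r t i 0 * err n (E ^~ t) i 0.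
  have nE : n = n.-1.+1 by rewrite prednK.
  rewrite nE; apply: (@error_chain_dissipation _ _ (fun k => err k (E ^~ t) i 0)
    (fun k => err k (jshift (E ^~ t)) i 0) (al 0 i)) => //; first by rewrite mxE.
    by move=> k _; rewrite err_rec !mxE.
  by rewrite -nE rE; ring.
have Ut i j := Utilde_ball i j Dt zR.
have reg := @regulation_dissipation R m (fun i => r t i 0)
  (fun i => err n (jshift (E ^~ t)) i 0) (fun i => err n (E ^~ t) i 0)
  (fun i => s t i 0) (fun i => Nbar h g S al xr t i 0)
  (fun i => Ntilde h g S al xr (x ^~ t) t i 0) (fun i => d 0 i) (fun i => c 0 i)
  (fun i => al 0 i) diag_gain (fun i => kd`_i) (fun i => zN i 0) residual_gain beta
  (U (X t)) (Ubar U xr t) zO (fun i j => rhoU i j Rb) coupling_bound (rhoN Rb) (zn t) kp.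
have hd2 i : d 0 i ^+ 2 = 1 by case: (d1 i) => ->; rewrite ?sqrrN expr1n.
have hNt' i : `|Ntilde h g S al xr (x ^~ t) t i 0| <= rhoN Rb * zn t.
  apply: le_trans (entry_le_enorm _ _ _) _; apply: le_trans hNt _.
  by have [_ H _] := rhoN_fun; apply: ler_wpM2r => //; exact: H.
have hO (i j : 'I_m) : (i < j)%N -> `|d 0 i * Ubar U xr t i j * d 0 j| <= zO i j.
  move=> ij; have := Omega_bound t0t i j.
  have -> : Omega U d xr t i j = d 0 i * (Ubar U xr t i j - (i == j)%:R) * d 0 j.
    by rewrite /Omega mul_mx_diag mxE mul_diag_mx !mxE.
  have -> : (i == j) = false by apply/eqP => ijE; rewrite ijE ltnn in ij.
  by rewrite subr0.
have hu i j := U_ball i j Dt zR.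
have {}reg := reg rE hd2 (Uut (X t)).2 (Uut (X t)).1 hNb hNt' hO Ut hu hs hse c_gt0
  al_gt0 z0 (fun i => erefl) diag_gain_ge0 (fun i => erefl) (fun i => erefl) kp_large kd_large.
have EN i : Nfun h g S al xr (x ^~ t) t i 0 =
    Nbar h g S al xr t i 0 + Ntilde h g S al xr (x ^~ t) t i 0.
  have subE (A B : 'cV[R]_m) : (A - B) i 0 = A i 0 - B i 0 by rewrite !mxE.
  by rewrite /Ntilde subE; ring.
have E2 : \sum_i r t i 0 * (Nfun h g S al xr (x ^~ t) t i 0 - err n (E ^~ t) i 0
       - d 0 i * \sum_j U (X t) i j * (d 0 j * (diag_gain j * r t j 0 + c 0 j * s t j 0)))
   + \sum_i c 0 i * (err n (jshift (E ^~ t)) i 0 * s t i 0) =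
   \sum_i (r t i 0 * (Nbar h g S al xr t i 0 + Ntilde h g S al xr (x ^~ t) t i 0
       - d 0 i * \sum_j U (X t) i j * (d 0 j * (diag_gain j * r t j 0 + c 0 j * s t j 0)))
     + c 0 i * (err n (jshift (E ^~ t)) i 0 * s t i 0))
   - \sum_i r t i 0 * err n (E ^~ t) i 0.
  by rewrite -sumrB -big_split; apply: eq_bigr => i _ /=; rewrite EN; ring.
rewrite /energy_rate -addrA E2 /dissipation_rate.
have := ler_sum (index_enum 'I_m) (fun i (_ : true) => chain i).
rewrite big_split /= sumrN -mulr_sumr.
have zE := zvec_sqr al n (E ^~ t); rewrite -/(zn t) big_split /= in zE.
have h0 : 0 <= \sum_i \sum_(k < n) err k.+1 (E ^~ t) i 0 ^+ 2.
  by rewrite sumr_ge0// => i _; rewrite sumr_ge0// => k _; exact: sqr_ge0.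
have h1 : 0 <= \sum_i r t i 0 ^+ 2 by rewrite sumr_ge0// => k _; exact: sqr_ge0.
rewrite -/(r t) in zE.
move: reg; rewrite zE; lra.
Qed.

Section Regularity.
Variable T' : \bar R.
Hypotheses (TT : (T' <= T)%E) (bx : forall j, (j <= n)%N -> mbnd (time_dom t0 T') (x j))
  (bt : mbnd (time_dom t0 T') tau).
Local Notation D := (time_dom t0 T').

Lemma loop_E_bnd j : (j <= n)%N -> mbnd D (E j).
Proof. by move=> jn; apply: (E_bnd xr_ref jn); exact: bx. Qed.

Lemma loop_E_lip j : (j <= n)%N -> mlip D (E j).
Proof.
by move=> jn; apply: (E_lip xr_ref jn); exact: (signals_lip h_C1 g_C1 xr_ref sol TT bx bt).
Qed.

Lemma loop_err_bnd k : (k <= n)%N -> mbnd D (fun t => err k (E ^~ t)).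
Proof.
move=> kn; apply: mbnd_err => j jk; apply: loop_E_bnd.
exact: ltnW (leq_trans jk kn).
Qed.

Lemma loop_err_lip k : (k <= n)%N -> mlip D (fun t => err k (E ^~ t)).
Proof.
move=> kn; apply: mlip_err => j jk; apply: loop_E_lip.
exact: ltnW (leq_trans jk kn).
Qed.

Lemma loop_errd_lip : mlip D (fun t => err n (jshift (E ^~ t))).
Proof. by apply: (@mlip_err _ _ D n (fun j => E j.+1)) => j jn; exact: loop_E_lip. Qed.

Lemma loop_r_bnd : mbnd D r.
Proof. exact: mbnd_filtered loop_E_bnd. Qed.

Lemma loop_r_lip : mlip D r.
Proof. exact: mlip_filtered loop_E_bnd loop_E_lip. Qed.

Lemma energy_lip : lip D V.
Proof.
have bX : mbnd D X by apply: mbnd_state => k kn; apply: bx; exact: ltnW.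
have bX' : mbnd D (fun t => state n (jshift (x ^~ t))).
  by apply: (mbnd_state (x := fun j => x j.+1)) => k kn; exact: bx.
have lX : mlip D X.
  apply: mlip_state => k kn; apply: (signals_lip h_C1 g_C1 xr_ref sol TT bx bt).
  exact: ltnW.
have dX t : t0 < t -> (t%:E < T')%E -> mder X t (state n (jshift (x ^~ t))).
  by move=> t0t tT; apply: (X_deriv sol) => //; exact: lt_le_trans TT.
have bM := mcomp_bnd (C1_continuous M_C1) bX.
have lM := mcomp_lip M_C1 bX bX' lX dX.
have rT_b : mbnd D (fun t => (r t)^T).
  by move=> i j; apply: eq_bnd (loop_r_bnd j i) => t _; rewrite [RHS]mxE.
have rT_l : mlip D (fun t => (r t)^T).
  by move=> i j; apply: eq_lip (loop_r_lip j i) => t _; rewrite [RHS]mxE.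
apply: lipD; apply: lipZ; last first.
  exact: (mlipM (mbndM rT_b bM) loop_r_bnd (mlipM rT_b bM rT_l lM) loop_r_lip 0 0).
apply: lip_sum => i _; apply: lip_sum => k _; apply: lip_sqr.
  exact: loop_err_bnd.
exact: loop_err_lip.
Qed.

Lemma zn_sqr_lip : lip D (fun t => zn t ^+ 2).
Proof.
apply: (@eq_lip _ _ (fun t => \sum_i (\sum_(k < n) err k.+1 (E ^~ t) i 0 ^+ 2 + r t i 0 ^+ 2))).
  by move=> t _; rewrite [RHS]zvec_sqr.
apply: lip_sum => i _; apply: lipD.
  by apply: lip_sum => k _; apply: lip_sqr; [exact: loop_err_bnd|exact: loop_err_lip].
by apply: lip_sqr; [exact: loop_r_bnd|exact: loop_r_lip].
Qed.

End Regularity.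

(** The integral of [dissipation_rate] is bounded with the help of the bound on
    the integral of |e_{n,i}'|: since beta_i (1 + gam2 / al_i) <= c_i, the
    integral of |e_{n,i}| gets a non-positive coefficient and the final value
    |e_{n,i}(b)| is compensated by the term c_i |e_{n,i}|. The right-hand side
    involves the initial instant only. *)
Lemma energy_estimate b : t0 <= b -> (b%:E < T)%E ->
  error_rate_bound (n := n) xr t0 x T gam1 gam2 ->
  (forall t, t0 <= t -> t < b -> zn t <= Rb) ->
  V b + 12^-1 * sint t0 b (fun t => zn t ^+ 2) <=
  V t0 + \sum_i (c 0 i * `|err n (E ^~ t0) i 0| + beta i * gam1).
Proof.
move=> t0b bT rate zR; have [b' bb' bT'] := between bT.
have [bx bt] := local_bnd h_C1 g_C1 xr_ref sol bT'.
have TT := ltW bT'.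
have sub : `[t0, b] `<=` time_dom t0 b'%:E by apply: dom_itv; rewrite lte_fin.
have len i : lip `[t0, b] (fun t => `|err n (E ^~ t) i 0|).
  by apply: lip_norm; apply: lip_sub sub _; exact: (loop_err_lip TT bx bt (leqnn n) i 0).
have led i : lip `[t0, b] (fun t => `|err n (jshift (E ^~ t)) i 0|).
  by apply: lip_norm; apply: lip_sub sub _; exact: (loop_errd_lip TT bx bt i 0).
have lz : lip `[t0, b] (fun t => zn t ^+ 2).
  by apply: lip_sub sub _; exact: (zn_sqr_lip TT bx bt).
have lV : lip `[t0, b] V by apply: lip_sub sub _; exact: (energy_lip TT bx bt).
(* |e_{n,i}| in Phi accounts for the integral of e_{n,i}' s_i *)
pose Phi t := V t + \sum_i c 0 i * `|err n (E ^~ t) i 0|.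
have lPhi : lip `[t0, b] Phi.
  by apply: lipD => //; apply: lip_sum => i _; exact: lipZ.
pose q i t := beta i * `|err n (jshift (E ^~ t)) i 0|
      + (beta i - c 0 i) * al 0 i * `|err n (E ^~ t) i 0|.
have lq i : lip `[t0, b] (q i) by apply: lipD; exact: lipZ.
have lG : lip `[t0, b] dissipation_rate.
  exact: (lipD (lipN (lipZ 12^-1 lz))
    (lip_sum (index_enum _) (P := predT) (fun i _ => lq i))).
have good : {ae mu, forall t, t0 < t -> t < b ->
    mder tau t (taud t) /\ mder (xr n) t (xr n.+1 t) /\
    (forall i, `|Nbar h g S al xr t i 0| <= zN i 0) /\
    enorm (Ntilde h g S al xr (x ^~ t) t) <= rhoN (zn t) * zn t}.
  have := aeI (aeI (control_deriv_ae h_C1 g_C1 xr_ref sol bT) (ref_deriv_ae xr_ref b))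
      (aeI Nbar_bound Ntilde_bound).
  apply: aeS => t [[H1 H2] [H3 H4]] t0t tb; split; first exact: H1.
  split; first exact: H2.
  by split; [exact: H3 (ltW t0t)|exact: H4 (ltW t0t) (x ^~ t)].
have main : Phi b - Phi t0 <= sint t0 b dissipation_rate.
  apply: lip_le_sint => //; first exact: lip_continuous.
  apply: aeS good => t Ht t0t tb e e0; have [dtau [dxr [hNb hNt]]] := Ht t0t tb.
  have tT : (t%:E < T)%E by apply: lt_trans bT; rewrite lte_fin.
  have Dt : time_dom t0 T t by split=> //; exact: ltW.
  have dV := energy_deriv t0t tT dtau dxr.
  have de i : is_derive t (1 : R) (fun u => err n (E ^~ u) i 0) (err n (jshift (E ^~ t)) i 0).
    by apply: mder_err => j jn; exact: (E_deriv xr_ref sol).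
  (* Freezing s at time t gives a differentiable function whose increment up to t
     dominates the one of Phi. *)
  pose Psi u := V u + \sum_i c 0 i * s t i 0 * err n (E ^~ u) i 0.
  pose dPsi := energy_rate t
    + \sum_i c 0 i * (err n (jshift (E ^~ t)) i 0 * s t i 0).
  have dP : is_derive t (1 : R) Psi dPsi.
    apply: (is_derive_ext (is_deriveD dV (@is_derive_sumf R _ (index_enum 'I_m) predT _ _ t
      (fun i _ => is_derive_mul (is_derive_cst (c 0 i * s t i 0) t 1) (de i))))) => //.
    by congr (_ + _); apply: eq_bigr => i _; rewrite /cst /=; ring.
  have [_ _ _ _ Hs] := sol.
  have diss := dissipation_pointwise Dt (zR t (ltW t0t) tb) hNb hNt.
  have left := is_derive_left dP e0.
  near=> u.
  have tu : 0 <= t - u by rewrite subr_ge0; near: u; exact: nbhs_left_le.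
  have : `|Psi t - Psi u - dPsi * (t - u)| <= e * (t - u) by near: u.
  move=> /ler_normlP[_ H].
  have habs : \sum_i c 0 i * `|err n (E ^~ t) i 0| - \sum_i c 0 i * `|err n (E ^~ u) i 0|
     <= \sum_i c 0 i * s t i 0 * err n (E ^~ t) i 0 - \sum_i c 0 i * s t i 0 * err n (E ^~ u) i 0.
    rewrite -!sumrB; apply: ler_sum => i _; rewrite -!mulrBr -mulrA.
    apply: ler_wpM2l; first exact: ltW.
    apply: abs_subgradient; first exact: Sgn_value_le1 (Hs t Dt) i.
    exact: Sgn_value_mul (Hs t Dt) i.
  have := ler_wpM2r tu diss; rewrite -/dPsi; move: H habs; rewrite /Phi /Psi.
  lra.
have intG : sint t0 b dissipation_rate = - (12^-1 * sint t0 b (fun t => zn t ^+ 2)) +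
    \sum_i (beta i * sint t0 b (fun t => `|err n (jshift (E ^~ t)) i 0|)
     + (beta i - c 0 i) * al 0 i * sint t0 b (fun t => `|err n (E ^~ t) i 0|)).
  rewrite /dissipation_rate sint_lipD; last 2 first.
  - exact: (lipN (lipZ 12^-1 lz)).
  - exact: (lip_sum (index_enum _) (P := predT) (fun i _ => lq i)).
  congr (_ + _).
    have -> : (fun t => - (12^-1 * zn t ^+ 2)) = (fun t => (- 12^-1) * zn t ^+ 2).
      by apply/funext => t; rewrite mulNr.
    by rewrite sint_lipZ// mulNr.
  rewrite sint_lip_sum//; apply: eq_bigr => i _.
  by rewrite sint_lipD ?sint_lipZ//; exact: lipZ.
have term i : beta i * sint t0 b (fun t => `|err n (jshift (E ^~ t)) i 0|)
     + (beta i - c 0 i) * al 0 i * sint t0 b (fun t => `|err n (E ^~ t) i 0|)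
     - c 0 i * `|err n (E ^~ b) i 0| <= beta i * gam1.
  have Db : time_dom t0 T b by [].
  have := rate i b Db; rewrite -[traj_err xr x b]/(E ^~ b).
  set I1 := sint t0 b _; set I2 := sint t0 b _ => hI.
  have al_gt0 : 0 < al 0 i by apply: lt_le_trans (al_ge i); rewrite invr_gt0.
  have I20 : 0 <= I2 by apply: sint_ge0 => t; exact: normr_ge0.
  have b0 : 0 <= beta i.
    rewrite addr_ge0 ?(ltW (zN_gt0 _))// sumr_ge0// => j _.
    by rewrite mulr_ge0 ?(ltW (zO_gt0 _ _)) ?(ltW (c_gt0 _)).
  have cb : beta i + beta i * (gam2 / al 0 i) <= c 0 i.
    by have := c_large i; rewrite mulrDr mulr1.
  have ga0 : 0 <= beta i * (gam2 / al 0 i) by rewrite mulr_ge0// divr_ge0// ltW.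
  have h1 := ler_wpM2l b0 hI.
  have h2 : (beta i - c 0 i) * `|err n (E ^~ b) i 0| <= 0.
    by rewrite mulr_le0_ge0// subr_le0; lra.
  have h3 : (beta i * gam2 + (beta i - c 0 i) * al 0 i) * I2 <= 0.
    rewrite mulr_le0_ge0//.
    have := ler_wpM2r (ltW al_gt0) cb.
    have -> : (beta i + beta i * (gam2 / al 0 i)) * al 0 i = beta i * al 0 i + beta i * gam2.
      by field; exact: lt0r_neq0.
    lra.
  move: h1 h2 h3; rewrite /I1 /I2; lra.
have := ler_sum (index_enum 'I_m) (fun i (_ : true) => term i).
rewrite [leLHS]sumrB => hterm.
move: main; rewrite intG /Phi => main.
rewrite [in leRHS]big_split /=; move: main hterm.
lra.
Unshelve. all: by end_near. Qed.

Variable (mlow : R).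
Hypotheses (mlow_gt0 : 0 < mlow)
  (M_lower : forall X (chi : 'cV[R]_m), mlow * enorm chi ^+ 2 <= qform (Mmat S X) chi).

Definition energy_coercivity : R := 2^-1 * Num.min 1 mlow.

Lemma energy_coercivity_gt0 : 0 < energy_coercivity.
Proof. by rewrite mulr_gt0 ?invr_gt0// lt_min ltr01. Qed.

Lemma energy_coercive e Y : energy_coercivity * enorm (zvec al n e) ^+ 2 <= energy e Y.
Proof.
rewrite zvec_sqr /energy -mulrDr /energy_coercivity -mulrA ler_pM2l ?invr_gt0//.
rewrite big_split /= mulrDr; apply: lerD.
  rewrite ler_piMl ?ge_min ?lexx// sumr_ge0// => i _.
  by rewrite sumr_ge0// => k _; exact: sqr_ge0.
apply: le_trans (M_lower _ _).
have -> : enorm (filtered al n e) ^+ 2 = \sum_i filtered al n e i 0 ^+ 2.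
  by rewrite enorm_sqr; apply: eq_bigr => i _; rewrite big_ord1.
rewrite ler_wpM2r ?ge_min ?lexx ?orbT// sumr_ge0// => i _; exact: sqr_ge0.
Qed.

Hypothesis rate : error_rate_bound (n := n) xr t0 x T gam1 gam2.
Variable (W : R).
Hypothesis W_init : V t0 + \sum_i (c 0 i * `|err n (E ^~ t0) i 0| + beta i * gam1) <= W.
Hypotheses (Rb_ge0 : 0 <= Rb) (Rb_large : W < energy_coercivity * Rb ^+ 2).

(** At the first time at which |z| reaches Rb, the energy estimate holds since
    |z| < Rb before, and it contradicts the choice of Rb. *)
Lemma zn_le t : time_dom t0 T t -> zn t <= Rb.
Proof.
move=> [t0t tT]; rewrite leNgt; apply/negP => zt.
have [b tb bT] := between tT.
have [bx bt] := local_bnd h_C1 g_C1 xr_ref sol bT.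
have sub : `[t0, t] `<=` time_dom t0 b%:E by apply: dom_itv; rewrite lte_fin.
have lz := lip_sub sub (zn_sqr_lip (ltW bT) bx bt).
have zt2 : Rb ^+ 2 <= zn t ^+ 2 by rewrite ler_pXn2r ?nnegrE ?enorm_ge0// ltW.
have [t1 [/andP[t01 t1t] zt1 Ht1]] := first_time t0t lz zt2.
have t1T : (t1%:E < T)%E by apply: le_lt_trans tT; rewrite lee_fin.
have zR u : t0 <= u -> u < t1 -> zn u <= Rb.
  move=> t0u ut; have := Ht1 u t0u ut.
  by rewrite ltr_pXn2r ?nnegrE ?enorm_ge0//; exact: ltW.
have := energy_estimate t01 t1T rate zR.
have := energy_coercive (E ^~ t1) (X t1); rewrite -/(V t1) -/(zn t1).
have := ler_wpM2l (ltW energy_coercivity_gt0) zt1.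
have : 0 <= sint t0 t1 (fun t => zn t ^+ 2) by apply: sint_ge0 => u; exact: sqr_ge0.
by move: W_init Rb_large; lra.
Qed.

Lemma loop_x_bnd j : (j <= n)%N -> mbnd (time_dom t0 T) (x j).
Proof.
move=> jn; have [C [C0 HC]] := jet_le_zvec al n_gt0.
apply: (@eq_mbnd _ _ _ _ (fun t => xr j t - E j t)).
  by move=> t _; rewrite /E opprB addrC subrK.
apply: mbndD.
  by apply: mbnd_sub (ref_bnd xr_ref jn); exact: dom_ref.
apply: mbndN => i k; rewrite ord1; exists (C * Rb) => t Dt.
by apply: le_trans (HC (E ^~ t) j i jn) _; apply: ler_wpM2l => //; exact: zn_le.
Qed.

(** U tau = D M (x^(n) - h) is bounded, and U is unit upper triangular. *)
Lemma loop_control_bnd : mbnd (time_dom t0 T) tau.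
Proof.
have bX : mbnd (time_dom t0 T) X by apply: mbnd_state => k kn; apply: loop_x_bnd; exact: ltnW.
have [d1 SP Uut gE] := g_SDU.
apply: (@backsubst_bnd _ _ _ (fun t => U (X t))) => //.
  by move=> i j; exists (coupling_bound i j) => t Dt; apply: U_ball => //; exact: zn_le.
apply: (@eq_mbnd _ _ _ _ (fun t => diag_mx d *m (Mmat S (X t) *m (x n t - h (X t))))).
  move=> t Dt; rewrite (x_top_eq sol Dt) (addrC (h _)) addrK.
  have -> : Mmat S (X t) *m (g (X t) *m tau t) = diag_mx d *m (U (X t) *m tau t).
    by rewrite !mulmxA (Mmat_g g_SDU).
  move: (U (X t) *m tau t) => w; apply/colP => i.
  rewrite !mul_diag_mx !mxE mulrA.
  by case: (d1 i) => ->; rewrite ?mulrNN mulr1 mul1r.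
apply: mbndM; first exact: mbnd_cst.
apply: mbndM; first by apply: mcomp_bnd bX; exact: C1_continuous.
apply: mbndD; first exact: loop_x_bnd.
by apply: mbndN; apply: mcomp_bnd bX; exact: C1_continuous.
Qed.

Lemma loop_signals_bounded : signals_bounded (n := n) d al xr c K t0 x s T.
Proof.
pose D := time_dom t0 T.
have bx := loop_x_bnd.
have bE j : (j <= n)%N -> mbnd D (E j) by move=> jn; apply: (E_bnd xr_ref jn); exact: bx.
have [Bx HBx] := choice (fun j : 'I_n.+1 => enorm_mbnd (bx j (leq_ord j))).
have be (i : 'I_n.+1) : mbnd D (fun t => err i (E ^~ t)).
  by apply: mbnd_err => j ji; apply: bE; exact: ltnW (leq_trans ji (leq_ord i)).
have [Be HBe] := choice (fun i => enorm_mbnd (be i)).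
have br : mbnd D r := mbnd_filtered al bE.
have [Br HBr] := enorm_mbnd br.
have [Bt HBt] := enorm_mbnd loop_control_bnd.
have bs : mbnd D s.
  move=> i j; rewrite ord1; exists 1 => t Dt; have [_ _ _ _ Hs] := sol.
  exact: Sgn_value_le1 (Hs t Dt) i.
have [Bd HBd] : exists B, forall t, D t -> enorm (taud t) <= B.
  apply: enorm_mbnd; apply: mbndD; last exact: mbndM (mbnd_cst _ _) bs.
  exact: mbndM (mbnd_cst _ _) br.
pose B := \sum_i `|Bx i| + \sum_i `|Be i| + `|Br| + `|Bt| + `|Bd|.
have sx0 : 0 <= \sum_i `|Bx i| by rewrite sumr_ge0.
have se0 : 0 <= \sum_i `|Be i| by rewrite sumr_ge0.
have [r0 bt0 bd0] : [/\ 0 <= `|Br|, 0 <= `|Bt| & 0 <= `|Bd|] by [].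
have up (I : finType) (F : I -> R) k : F k <= \sum_i `|F i|.
  by apply: le_trans (ler_norm _) _; rewrite (bigD1 k)//= lerDl sumr_ge0.
exists B => t Dt; split.
- move=> j jn; have := HBx (Ordinal (jn : (j < n.+1)%N)) t Dt.
  by have := up _ Bx (Ordinal (jn : (j < n.+1)%N)); rewrite /B /=; lra.
- move=> i /andP[_ i_n]; have := HBe (Ordinal (i_n : (i < n.+1)%N)) t Dt.
  by have := up _ Be (Ordinal (i_n : (i < n.+1)%N)); rewrite /B /=; lra.
- by have := HBr t Dt; have := ler_norm Br; rewrite /B /r; lra.
- by have := HBt t Dt; have := ler_norm Bt; rewrite /B /tau; lra.
- by have := HBd t Dt; have := ler_norm Bd; rewrite /B /taud; lra.
Qed.

Lemma loop_tracking : T = +oo%E -> tracking (n := n) xr x.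
Proof.
move=> Ty; have Dy : time_dom t0 T = `[t0, +oo[%classic by rewrite Ty time_domy.
have lz : lip `[t0, +oo[ (fun t => zn t ^+ 2).
  by rewrite -Dy; apply: (zn_sqr_lip (lexx T)) loop_control_bnd; exact: loop_x_bnd.
have Dt t : t0 <= t -> time_dom t0 T t by move=> t0t; rewrite Dy /= in_itv /= t0t.
have z2 : zn t ^+ 2 @[t --> +oo] --> 0.
  apply: (barbalat (M := 12 * W) lz) => [t _|t t0t]; first exact: sqr_ge0.
  have := energy_estimate t0t (Dt t t0t).2 rate (fun u t0u _ => zn_le (Dt u t0u)).
  have := energy_coercive (E ^~ t) (X t); rewrite -/(V t).
  have : 0 <= energy_coercivity * zn t ^+ 2.
    by rewrite mulr_ge0 ?sqr_ge0// ltW// energy_coercivity_gt0.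
  by move: W_init; rewrite /zn; lra.
have [C [C0 HC]] := jet_le_zvec al n_gt0.
move=> i i_n; apply: mx_cvg => k l; rewrite ord1 mxE.
apply/cvgrPdist_le => e e0.
have C1_gt0 : 0 < C + 1 by rewrite ltr_wpDl.
have d0 : 0 < (e / (C + 1)) ^+ 2 by rewrite exprn_gt0// divr_gt0.
move/cvgrPdist_le : z2 => /(_ _ d0); apply: filterS => t.
rewrite !sub0r !normrN (ger0_norm (sqr_ge0 _)) ler_pXn2r ?nnegrE ?enorm_ge0//.
  move=> zt; apply: le_trans (HC (E ^~ t) i k i_n) _.
  apply: le_trans (ler_wpM2l C0 zt) _.
  by rewrite mulrCA ger_pMr// ler_pdivrMr ?mul1r ?lerDl.
by rewrite divr_ge0 ?(ltW e0) ?(ltW C1_gt0).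
Qed.

End Lyapunov.

(** * Choice of the gains *)

Section Gains.
Context {R : realType}.

(** The threshold of the i-th entry of the final list may look at the entries
    that follow it, which are those chosen before. *)
Lemma successively_large_of_thresholds (th : seq R -> R) (P : seq R -> Prop) k l :
  (forall l', size l' = (k + size l)%N -> drop k l' = l ->
    (forall i, (i < k)%N -> 0 < l'`_i /\ th (drop i.+1 l') < l'`_i) -> P l') ->
  successively_large k l P.
Proof.
elim: k l => [|k IH] l H /=; first by apply: H => //; rewrite drop0.
exists (th l) => c c0 thc; apply: IH => l' sl' dl' Hl'.
have kl' : (k < size l')%N by rewrite sl' /= addnS ltnS leq_addr.
have := drop_nth 0 kl'; rewrite dl' => -[cE lE].
apply: H => // [|i]; first by rewrite sl' /= addnS addSn.
rewrite ltnS leq_eqVlt => /predU1P[->|/Hl'//].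
by rewrite -lE -cE.
Qed.

End Gains.

Section InitialState.
Context {R : realType} {m n : nat}.
Variables (h : 'M[R]_(m, n) -> 'cV[R]_m) (g : 'M[R]_(m, n) -> 'M[R]_m).
Variables (d al c : 'rV[R]_m) (K : 'M[R]_m) (xr : nat -> R -> 'cV[R]_m) (t0 : R).

(** The control vanishes at [t0], so even x^(n)(t0) = h(X0) does not depend on the
    gains; this is what allows gains that depend on the initial energy. *)
Definition initial_jet (X0 : 'M[R]_(m, n)) (j : nat) : 'cV[R]_m :=
  if insub j is Some k then col k X0 else h X0.

Lemma initial_jetE T x s X0 : (t0%:E < T)%E ->
  closed_loop_solution h g d al xr c K t0 x s T X0 ->
  forall j, (j <= n)%N -> x j t0 = initial_jet X0 j.
Proof.
move=> t0T [HX Hd Hn _ _] j; rewrite /initial_jet leq_eqVlt => /predU1P[->|jn].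
  rewrite insubF ?ltnn// Hn ?HX; last by split.
  have vint0 p (f : R -> 'cV[R]_p) : vint t0 t0 f = 0.
    by apply/colP => i; rewrite !mxE /sint set_itv1 Rintegral_set1.
  have -> : control (n := n) d al xr c K t0 x s t0 = 0.
    by rewrite /control /Pi_signal !vint0 subrr !mulmx0 !addr0 mulmx0.
  by rewrite mulmx0 addr0.
rewrite insubT; apply/colP => i.
by rewrite mxE -HX mxE.
Qed.

End InitialState.

Theorem theorem2 (R : realType) (m n : nat) (m_gt0 : (0 < m)%N)
  (n_gt0 : (0 < n)%N) (t0 : R)
  (* plant *)
  (h : 'M[R]_(m, n) -> 'cV[R]_m) (g S U : 'M[R]_(m, n) -> 'M[R]_m)
  (d : 'rV[R]_m)
  (g_minors : forall X, leading_minors_neq0 (g X))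
  (g_SDU : SDU_decomposition g S U d)
  (h_C1 : C1 h) (g_C1 : C1 g) (M_C1 : C1 (Mmat S))
  (mlow : R) (mbar : 'M[R]_(m, n) -> R)
  (mlow_gt0 : 0 < mlow) (mbar_gt0 : forall X, 0 < mbar X)
  (mbar_mono : forall X Y, enorm X <= enorm Y -> mbar X <= mbar Y)
  (M_bounds : forall X (chi : 'cV[R]_m),
    mlow * enorm chi ^+ 2 <= qform (Mmat S X) chi <= mbar X * enorm chi ^+ 2)
  (* reference *)
  (xr : nat -> R -> 'cV[R]_m) (xr_ref : reference (n := n) xr t0)
  (* gain matrices alpha = diag al and C = diag c *)
  (al c : 'rV[R]_m)
  (al_posdef : sym_posdef (diag_mx al)) (c_posdef : sym_posdef (diag_mx c))
  (* standing bounds *)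
  (rhoN : R -> R) (rhoU : 'I_m -> 'I_m -> R -> R)
  (rhoN_fun : bounding_fun rhoN) (rhoU_fun : forall i j, bounding_fun (rhoU i j))
  (Ntilde_bound : {ae (@lebesgue_measure R), forall t, t0 <= t ->
    forall p : nat -> 'cV[R]_m,
      enorm (Ntilde h g S al xr p t)
      <= rhoN (enorm (zvec al n (ejet xr p t))) * enorm (zvec al n (ejet xr p t))})
  (Utilde_bound : forall t, t0 <= t ->
    forall (p : nat -> 'cV[R]_m) (i j : 'I_m),
      `|Utilde U xr p t i j|
      <= rhoU i j (enorm (zvec al n (ejet xr p t))) * enorm (zvec al n (ejet xr p t)))
  (zN : 'cV[R]_m) (zU zO : 'M[R]_m)
  (zN_gt0 : forall i, 0 < zN i 0) (zU_gt0 : forall i j, 0 < zU i j)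
  (zO_gt0 : forall i j, 0 < zO i j)
  (Nbar_bound : {ae (@lebesgue_measure R), forall t, t0 <= t ->
    forall i, `|Nbar h g S al xr t i 0| <= zN i 0})
  (Ubar_bound : forall t, t0 <= t -> forall i j, `|Ubar U xr t i j| <= zU i j)
  (Omega_bound : forall t, t0 <= t ->
    forall i j, `|Omega U d xr t i j| <= zO i j)
  (* condition (i) *)
  (lmin : R) (lmin_al : is_lambda_min (diag_mx al) lmin) (lmin_ge : 2^-1 <= lmin)
  (* condition (ii); the sum is empty for the last index *)
  (gam1 gam2 : R) (gam1_gt0 : 0 < gam1) (gam2_gt0 : 0 < gam2)
  (c_large : forall i : 'I_m,
    (zN i 0 + \sum_(j < m | (i < j)%N) zO i j * c 0 j) * (1 + gam2 / al 0 i)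
    <= c 0 i)
  (* initial state *)
  (X0 : 'M[R]_(m, n)) :
  (* condition (iii): k_p, then k_{d,m-1}, ..., k_{d,1} above thresholds *)
  exists kp_min : R, forall kp : R, 0 < kp -> kp_min < kp ->
  successively_large m.-1 [::] (fun kd : seq R =>
    let K := gain_matrix m kp kd in
    forall (T : \bar R) (x : nat -> R -> 'cV[R]_m) (s : R -> 'cV[R]_m),
      (t0%:E < T)%E ->
      closed_loop_solution h g d al xr c K t0 x s T X0 ->
      error_rate_bound (n := n) xr t0 x T gam1 gam2 ->
      signals_bounded (n := n) d al xr c K t0 x s T /\
      (T = +oo%E -> tracking (n := n) xr x)).
Proof.
have al_gt0 := posdef_diag al_posdef; have c_gt0 := posdef_diag c_posdef.
have al_ge i : 2^-1 <= al 0 i := le_trans lmin_ge (lambda_min_le lmin_al i).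
have M_lower X chi : mlow * enorm chi ^+ 2 <= qform (Mmat S X) chi.
  by have /andP[] := M_bounds X chi.
pose beta := feedforward_bound c zN zO.
pose e0 := ejet xr (initial_jet h X0) t0.
pose W := energy S al e0 X0 + \sum_i (c 0 i * `|err n e0 i 0| + beta i * gam1).
pose kap := energy_coercivity mlow.
have kap0 : 0 < kap by exact: energy_coercivity_gt0.
(* kap Rb^2 = |W| + 1 exceeds the gain-independent bound W on the energy *)
pose Rb := Num.sqrt ((`|W| + 1) / kap).
have W1 : 0 < `|W| + 1 by rewrite ltr_wpDl.
have Rb_large : W < kap * Rb ^+ 2.
  rewrite sqr_sqrtr ?divr_ge0 ?(ltW W1) ?(ltW kap0)// mulrCA mulfV ?lt0r_neq0// mulr1.
  by rewrite (le_lt_trans (ler_norm W))// ltrDl.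
have Rb0 : 0 <= Rb by exact: sqrtr_ge0.
exists (\sum_i 3 * m%:R * residual_gain c rhoN rhoU Rb i ^+ 2) => kp kp0 kp_large.
have term_ge0 i : 0 <= 3 * m%:R * residual_gain c rhoN rhoU Rb i ^+ 2.
  by rewrite mulr_ge0 ?sqr_ge0// mulr_ge0.
have kp_ge i : 3 * m%:R * residual_gain c rhoN rhoU Rb i ^+ 2 <= kp.
  apply: le_trans (ltW kp_large); rewrite (bigD1 i)//= lerDl.
  by apply: sumr_ge0 => j _; exact: term_ge0.
pose lvl (i : 'I_m) (l : seq R) := m%:R / 2 * \sum_(j < m | (i < j)%N)
  (coupling_bound zU rhoU Rb i j * (1 + kp + l`_(j - i.+1))) ^+ 2.
have lvl_ge0 i l : 0 <= lvl i l.
  by rewrite mulr_ge0 ?divr_ge0// sumr_ge0// => j _; exact: sqr_ge0.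
(* when l holds the entries chosen so far, the next one has index
   m - 2 - size l; the sum selects that index *)
pose th (l : seq R) := \sum_(i < m | val i == (m.-1 - (size l).+1)%N) lvl i l.
apply: (@successively_large_of_thresholds _ th) => kd; rewrite addn0 => skd _ Hkd.
move=> K T x s t0T sol rate.
have kd_ge i : (i < m.-1)%N -> 0 < kd`_i by move=> /Hkd[].
have kd_ge0 (i : nat) : 0 <= kd`_i.
  have [/kd_ge/ltW//|im] := ltnP i m.-1; by rewrite nth_default ?skd.
have gain_ge0 (i : 'I_m) : 0 <= diag_gain kp kd i.
  by rewrite /diag_gain !addr_ge0// ltW.
have kd_large (i : 'I_m) : m%:R / 2 * \sum_(j < m | (i < j)%N)
    (coupling_bound zU rhoU Rb i j * diag_gain kp kd j) ^+ 2 <= kd`_i.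
  have [im|im] := ltnP i m.-1; last first.
    rewrite big_pred0 ?mulr0// => j; apply/negbTE; rewrite -leqNgt.
    by apply: leq_trans im; rewrite -ltnS prednK.
  have [_ /ltW] := Hkd i im; apply: le_trans.
  rewrite /th size_drop skd [leRHS](bigD1 i) /=; last first.
    by apply/eqP; rewrite /= subnSK// subKn// ltnW.
  have -> : lvl i (drop i.+1 kd) = m%:R / 2 * \sum_(j < m | (i < j)%N)
      (coupling_bound zU rhoU Rb i j * diag_gain kp kd j) ^+ 2.
    congr (_ * _); apply: eq_bigr => j ij.
    by rewrite /diag_gain nth_drop subnKC.
  by rewrite lerDl sumr_ge0// => j _; exact: lvl_ge0.
have jet0 j : (j <= n)%N -> ejet xr (x ^~ t0) t0 j = e0 j.
  by move=> jn; rewrite /ejet (initial_jetE t0T sol jn).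
have err0 k : (k <= n)%N -> err k (ejet xr (x ^~ t0) t0) = err k e0.
  by move=> kn; apply: eq_err => j jk; apply: jet0; exact: ltnW (leq_trans jk kn).
have fil0 : filtered al n (ejet xr (x ^~ t0) t0) = filtered al n e0.
  rewrite /filtered err0//; congr (_ + _); apply: eq_err => j jn.
  exact: jet0.
have W_init : energy S al (ejet xr (x ^~ t0) t0) (state n (x ^~ t0)) +
    \sum_i (c 0 i * `|err n (ejet xr (x ^~ t0) t0) i 0| + beta i * gam1) <= W.
  have [HX _ _ _ _] := sol.
  have enE : energy S al (ejet xr (x ^~ t0) t0) X0 = energy S al e0 X0.
    rewrite /energy fil0; congr (_ * _ + _); apply: eq_bigr => i _.
    by apply: eq_bigr => k _; rewrite err0.
  by rewrite HX enE err0.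
split; [apply: (loop_signals_bounded n_gt0 g_minors g_SDU h_C1 g_C1 M_C1 xr_ref
    zN_gt0 zO_gt0 al_ge c_gt0 rhoN_fun rhoU_fun Ntilde_bound Utilde_bound
    Nbar_bound Ubar_bound Omega_bound gam2_gt0 c_large gain_ge0 kp_ge kd_large
    sol mlow_gt0 M_lower rate W_init Rb0 Rb_large)
  |apply: (loop_tracking n_gt0 g_minors g_SDU h_C1 g_C1 M_C1 xr_ref
    zN_gt0 zO_gt0 al_ge c_gt0 rhoN_fun rhoU_fun Ntilde_bound Utilde_bound
    Nbar_bound Ubar_bound Omega_bound gam2_gt0 c_large gain_ge0 kp_ge kd_large
    sol mlow_gt0 M_lower rate W_init Rb0 Rb_large)].
Qed.
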